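(* Let $\Gamma$ be a chain of cycles of genus $g$ and let $r$ be an integer with $1 \leq r \leq g-2$. Then $w^r_{g-2+r}(\Gamma)=g-2-r$ if and only if either $\Gamma$ is hyperelliptic or $\Gamma$ is a Martens-special chain of cycles for rank $r$.
   Context: A chain of cycles of genus $g\ge 1$ is the metric graph obtained from $g$ metric circles $C_1,\dots,C_g$, with two distinct points $v_i,w_i$ on each $C_i$, by joining $w_i$ to $v_{i+1}$ ($1\le i\le g-1$) by a segment of positive length. Orient each $C_i$ so that the positively oriented arc from $v_i$ to $w_i$ is a shortest arc between them; let $\ell_i$ be the length of $C_i$ and $\ell(v_i,w_i)$ the length of that arc. The torsion profile is $(m_2,\dots,m_{g-1})$: $m_i=0$ if $\ell_i/\ell(v_i,w_i)$ is irrational, and otherwise $m_i$ is the smallest positive integer such that $m_i\,\ell(v_i,w_i)$ is an integer multiple of $\ell_i$. Divisors, effective divisors, rational functions (continuous piecewise affine with integer slopes, $\mathrm{div}(f)$ = sum over points of the outgoing slopes), linear equivalence and rank are as usual for metric graphs: rank is $-1$ if $D$ is not equivalent to an effective divisor, otherwise the largest $r$ such that for every effective $E$ of degree $r$ some effective $D'\sim D$ has $D'-E$ effective. The Brill–Noether rank $w^r_d(\Gamma)$ is $-1$ if there is no divisor of degree $d$ and rank $\ge r$, and otherwise the largest $w$ such that every effective divisor of degree $w+r$ is contained in some effective divisor of degree $d$ and rank $\ge r$. $\Gamma$ is hyperelliptic if it has a divisor of degree $2$ and rank $1$ (for chains of cycles this is equivalent to $m_i=2$ for all $2\le i\le g-1$).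 A chain of cycles of genus $g\ge 2r+3$ is Martens-special for rank $r$ (of type $k\ge 1$) if there exist integers $r+1<j_1<\dots<j_k<g-r$ with $j_{i+1}-j_i\ge r+1$ for $1\le i\le k-1$ such that $m_{j_i}\ne 2$ for $1\le i\le k$ and $m_i=2$ for all $2\le i\le g-1$ with $i\notin\{j_1,\dots,j_k\}$. *)

(* Defs.v *)
From HB Require Import structures.
From mathcomp Require Import all_boot all_order all_algebra.
From mathcomp Require Import all_classical all_reals all_analysis.
From mathcomp.multinomials Require Import freeg.

Set Implicit Arguments.
Unset Strict Implicit.
Unset Printing Implicit Defensive.

Import Order.TTheory GRing.Theory Num.Theory.
Import numFieldNormedType.Exports.

Local Open Scope classical_set_scope.
Local Open Scope ring_scope.

(* A metric graph is presented by a finite model: a finite multigraph (loops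
   and parallel edges allowed) with oriented edges, the edge e being a copy of
   the segment [0, edge_len e] running from edge_src e to edge_tgt e.
   Connectedness is not required; it holds for the chains of cycles below. *)
Record metric_graph (R : realType) := MetricGraph {
  vertex : finType;
  edge : finType;
  edge_src : edge -> vertex;
  edge_tgt : edge -> vertex;
  edge_len : edge -> R;
  edge_len_gt0 : forall e, 0 < edge_len e }.

Section MetricGraphs.
Variables (R : realType) (G : metric_graph R).

Definition inner_point : choiceType :=
  {x : edge G * R | 0 < x.2 < edge_len x.1}.

Definition point : choiceType := (vertex G + inner_point)%type.

(* The parametrization of e by [0, edge_len e], extended to all reals by
   clamping. *)
Definition edge_point (e : edge G) (t : R) : point :=
  if (insub (e, t) : option inner_point) is Some x then inr x
  else inl (if t <= 0 then edge_src e else edge_tgt e).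

(* Every piece is closed, so such an h is continuous on [a, b]. *)
Definition piecewise_affine_int (a b : R) (h : R -> R) : Prop :=
  exists s : seq R, [/\ path <%R a s, last a s = b &
    forall i, (i < size s)%N -> exists k : int,
      forall t, nth a (a :: s) i <= t <= nth a s i ->
        h t = h (nth a (a :: s) i) + k%:~R * (t - nth a (a :: s) i)].

Definition rational_function (f : point -> R) : Prop :=
  forall e, piecewise_affine_int 0 (edge_len e) (f \o edge_point e).

(* The slope of the germ of h at 0 on the right; it is unique when it exists,
   and 0 is a dummy value otherwise. *)
Definition slope0 (h : R -> R) : int :=
  xget 0 [set k : int | \forall s \near 0^'+, h s = h 0 + k%:~R * s].

(* The sum of the outgoing slopes of f at p, over the tangent directions at p;
   a loop contributes two directions at its base vertex. *)
Definition div_at (f : point -> R) (p : point) : int :=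
  match p with
  | inl v =>
      \sum_(e | edge_src e == v) slope0 (fun s => f (edge_point e s)) +
      \sum_(e | edge_tgt e == v)
         slope0 (fun s => f (edge_point e (edge_len e - s)))
  | inr x =>
      let: (e, t) := val x in
      slope0 (fun s => f (edge_point e (t + s))) +
      slope0 (fun s => f (edge_point e (t - s)))
  end.

Definition divisor := {freeg point / int}.

Definition effective (D : divisor) : Prop := fgle 0 D.

Definition lin_equiv (D D' : divisor) : Prop :=
  exists2 f, rational_function f &
    forall p, coeff p D' = coeff p D + div_at f p.

(* The default 0 is never reached in the uses below: when G is nonempty, P
   holds at 0 and is bounded by a degree. *)
Definition largest (P : set nat) : nat :=
  xget 0%N [set n | P n /\ forall m, P m -> (m <= n)%N].

Definition rank (D : divisor) : int :=
  if `[< exists2 D', lin_equiv D D' & effective D' >] then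
    Posz (largest [set r | forall E : divisor, effective E -> deg E = Posz r ->
      exists D', [/\ effective D', lin_equiv D D' & effective (D' - E)]])
  else -1.

Definition brill_noether_rank (r : nat) (d : int) : int :=
  if `[< exists D, deg D = d /\ Posz r <= rank D >] then
    Posz (largest [set w | forall E : divisor,
      effective E -> deg E = Posz (w + r) ->
      exists D, [/\ effective D, deg D = d, Posz r <= rank D
                  & effective (D - E)]])
  else -1.

Definition hyperelliptic : Prop := exists D, deg D = 2 /\ rank D = 1.

End MetricGraphs.

(* The cycle C_(i+1) is indexed by i : 'I_g (from 0). Its length is
   cycle_len i, and arc_len i is the length of the shortest arc between its
   two marked points; bridge_len i is the length of the segment joining
   w_(i+1) to v_(i+2). *)
Record chain_of_cycles (R : realType) (g : nat) := ChainOfCycles {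
  genus_gt0 : (0 < g)%N;
  cycle_len : 'I_g -> R;
  arc_len : 'I_g -> R;
  bridge_len : 'I_g.-1 -> R;
  arc_len_gt0 : forall i, 0 < arc_len i;
  arc_len_shortest : forall i, arc_len i <= cycle_len i - arc_len i;
  bridge_len_gt0 : forall i, 0 < bridge_len i }.

Section Chains.
Variables (R : realType) (g : nat) (C : chain_of_cycles R g).

(* (i, false) is the point v and (i, true) the point w of the i-th cycle. *)
Definition chain_vertex : finType := ('I_g * bool)%type.

(* inl (i, false) is the positively oriented arc from v to w on the i-th cycle,
   inl (i, true) the complementary arc from w to v, inr i the i-th bridge. *)
Definition chain_edge : finType := (('I_g * bool) + 'I_g.-1)%type.

Definition bridge_src (i : 'I_g.-1) : 'I_g := widen_ord (leq_pred g) i.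

Fact bridge_tgt_proof (i : 'I_g.-1) : (i.+1 < g)%N.
Proof. by rewrite -ltn_predRL. Qed.

Definition bridge_tgt (i : 'I_g.-1) : 'I_g := Ordinal (bridge_tgt_proof i).

Definition chain_src (e : chain_edge) : chain_vertex :=
  match e with inl x => x | inr i => (bridge_src i, true) end.

Definition chain_tgt (e : chain_edge) : chain_vertex :=
  match e with inl (i, b) => (i, ~~ b) | inr i => (bridge_tgt i, false) end.

Definition chain_len (e : chain_edge) : R :=
  match e with
  | inl (i, b) => if b then cycle_len C i - arc_len C i else arc_len C i
  | inr i => bridge_len C i
  end.

Fact chain_len_gt0 e : 0 < chain_len e.
Proof.
case: e => [[i []]|i] /=; last exact: bridge_len_gt0.
- exact: lt_le_trans (arc_len_gt0 C i) (arc_len_shortest C i).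
- exact: arc_len_gt0.
Qed.

Definition chain_graph : metric_graph R :=
  @MetricGraph R chain_vertex chain_edge chain_src chain_tgt
    chain_len chain_len_gt0.

(* torsion i is m_(i+1), since indices start at 0 here. The torsion profile
   consists of its values for 0 < i < g - 1; the values at the first and last
   cycles are never used. *)
Definition torsion (i : 'I_g) : nat :=
  if `[< irrational (cycle_len C i / arc_len C i) >] then 0%N
  else
    let P := [set m : nat | (0 < m)%N /\
      exists k : int, m%:R * arc_len C i = k%:~R * cycle_len C i] in
    xget 0%N [set m | P m /\ forall m', P m' -> (m <= m')%N].

(* j lists j_1 < ... < j_k, numbered from 1 as usual; the cycle indexed by
   i : 'I_g therefore has number i.+1. *)
Definition martens_special (r : nat) : Prop :=
  (2 * r + 3 <= g)%N /\
  exists j : seq nat,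
    [/\ (1 <= size j)%N,
        all (fun x => r + 1 < x < g - r)%N j,
        sorted (fun x y => x + (r + 1) <= y)%N j,
        (forall i : 'I_g, i.+1 \in j -> torsion i <> 2%N)
      & (forall i : 'I_g, (2 <= i.+1 <= g - 1)%N -> i.+1 \notin j ->
           torsion i = 2%N)].

End Chains.

(* Main.v *)
(* The condition on Brill-Noether ranks says that every effective E of degree
   g - 2 is contained in a divisor D of degree g - 2 + r and rank at least r.

   Equivalence on a chain of cycles is controlled by the Abel-Jacobi map into the
   product of the cycles. If D has rank at least r, sweeping the cycles from left
   to right, while subtracting k = 0, ..., r chips placed adversarially, gives
   r + 1 particles obeying an exclusion rule; each of them has to take two steps,
   and a step on the j-th cycle imposes a congruence on the j-th coordinate of D.
   Steps on at least r + 2 cycles are thus needed, and if exactly r + 2 cycles are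
   available, all of them but the first and the last must have torsion 2, since
   there two particles at distance 2 step together. Conversely, congruences on
   r + 2 such cycles give rank at least r.

   Taking for E one generic chip on each cycle but a and b, steps can only occur
   on a, b and the at most r cycles carrying chips of D - E. Hence a and b must lie
   in a common family of r + 2 cycles whose inner members have torsion 2. Such a
   family exists for all a < b if and only if any two cycles that are ends of the
   chain or have torsion different from 2 are at distance at least r + 1, that is,
   if the chain is hyperelliptic or Martens-special. *)

From HB Require Import structures.
From mathcomp Require Import all_boot all_order all_algebra.
From mathcomp Require Import all_classical all_reals all_analysis.
From mathcomp Require Import zify ring lra.
From mathcomp.multinomials Require Import freeg.
Require Import Defs.

Set Implicit Arguments.
Unset Strict Implicit.
Unset Printing Implicit Defensive.

Import Order.TTheory GRing.Theory Num.Theory.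
Import numFieldNormedType.Exports.

Local Open Scope classical_set_scope.
Local Open Scope ring_scope.

(** * Piecewise affine functions *)

Section PiecewiseAffine.
Variable R : realType.
Implicit Types (a b t u v M : R) (h : R -> R) (B : seq R).

(** The Abel-Jacobi map is used in one direction: equal degrees and congruent coordinates yield an
    explicit function. The obstruction comes from a maximum principle instead: a divisor with at
    most one chip on each cycle, none at a [w], and a negative coefficient at the last [w] has no
    effective representative. After n cycles, the position z of particle k counts the chips already
    spent, the k subtracted ones included, so that d - z chips remain for the rest of the chain. It
    grows by one on each cycle unless a step is taken, which requires the coordinate of a divisor
    without chip on that cycle. Without steps, particle r would end at g + r, while rank at least r
    keeps it within the degree g - 2 + r: hence two steps. A particle steps only if the one behind
    has stepped more often, which costs particle r another r cycles. When two particles at distance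
    2 step together, their congruences differ by twice the shortest arc; this number is positive and
    at most the length of the cycle, so it is that length. *)

Definition affine_on u v h : Prop :=
  exists k : int, forall t, u <= t <= v -> h t = h u + k%:~R * (t - u).

(** [B] is unordered and may contain repetitions and points outside [[a, b]]: adding two functions
    then only concatenates lists, with no common refinement to build. *)
Definition breaks B a b h : Prop :=
  forall u v, a <= u -> u <= v -> v <= b ->
    (forall x, x \in B -> ~~ (u < x < v)) -> affine_on u v h.

Lemma affine_on_sub u v u' v' h :
  affine_on u v h -> u <= u' -> v' <= v -> affine_on u' v' h.
Proof.
move=> [k hk] uu vv; exists k => t /andP[t1 t2].
rewrite (hk t) ?(hk u') ?lexx ?uu //=; first ring.
- by lra.
- by lra.
Qed.

Lemma affine_onD u v h1 h2 :
  affine_on u v h1 -> affine_on u v h2 -> affine_on u v (fun t => h1 t + h2 t).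
Proof.
move=> [k1 H1] [k2 H2]; exists (k1 + k2) => t ht.
by rewrite H1 // H2 // intrD; ring.
Qed.

Lemma affine_onN u v h : affine_on u v h -> affine_on u v (fun t => - h t).
Proof.
by move=> [k H]; exists (- k) => t ht; rewrite H // intrN; ring.
Qed.

Fixpoint affine_pieces a (s : seq R) h : Prop :=
  if s is c :: s' then affine_on a c h /\ affine_pieces c s' h else True.

Lemma piecewise_affine_pieces a b h : piecewise_affine_int a b h ->
  exists s, [/\ path <%R a s, last a s = b & affine_pieces a s h].
Proof.
case=> s [ps ls hs]; exists s; split=> // {b ls ps}.
elim: s a hs => //= c s IH a hs; split; first by have [k hk] := hs 0%N isT; exists k.
apply: IH => i ilt; have [k hk] := hs i.+1 ilt; exists k; move: hk => /=.
by rewrite !(@set_nth_default _ _ c a) //= ltnS ltnW.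
Qed.

Lemma piecewise_affine_breaks a b h :
  piecewise_affine_int a b h -> a <= b /\ exists B, breaks B a b h.
Proof.
case/piecewise_affine_pieces=> s [ps <- hs]; split.
  by elim: s a ps {hs} => //= c s IH a /andP[/ltW ac /IH]; exact: le_trans.
exists s => u v au uv; elim: s a ps hs au => [|c s IH] a /= ps hs au vb hB.
  exists 0 => t /andP[t1 t2]; have -> : t = u by lra.
  ring.
case/andP: ps => ac ps.
case: hs => hc hs.
have [uc|cu] := ltP u c; last first.
  apply: (IH c) => //.
  by move=> x xs; apply: hB; rewrite inE xs orbT.
have vc : v <= c.
  by have := hB c (mem_head _ _); rewrite uc /= -leNgt.
exact: affine_on_sub hc _ _.
Qed.

Lemma breaks_piecewise_affine B a b h :
  a < b -> breaks B a b h -> piecewise_affine_int a b h.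
Proof.
move=> ab hB.
(* A subdivision must increase strictly and end at [b]: hence [undup], the open interval and the
   added [b]. *)
pose s := sort <=%O (undup (b :: [seq x <- B | a < x < b])).
have us : uniq s by rewrite sort_uniq undup_uniq.
have ms x : (x \in s) = (x == b) || (x \in B) && (a < x < b).
  by rewrite mem_sort mem_undup inE mem_filter andbC.
have lts : sorted <%O s.
  by rewrite lt_sorted_uniq_le us sort_le_sorted.
have ps : path <%R a s.
  rewrite (path_sortedE lt_trans) lts andbT; apply/allP => x.
  by rewrite ms => /orP[/eqP->//|/andP[_ /andP[]]].
have st : sorted <%O (a :: s) by [].
have sz : (0 < size s)%N.
  have : b \in s by rewrite ms eqxx.
  by case: (s).
exists s; split => //.
- have hl : last a s \in s by case: (s) sz => //= c s' _; apply: mem_last.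
  have : last a s <= b.
    by move: hl; rewrite ms => /orP[/eqP->//|/andP[_ /andP[_ /ltW]]].
  have bs : b \in s by rewrite ms eqxx.
  have [j js <-] := nthP a bs => lel; apply/eqP; rewrite eq_le; apply/andP; split.
    by have := lel.
  have H := lt_sorted_leq_nth a st; have := H j.+1 (size s); rewrite !inE !ltnS leqnn js.
  by rewrite -[nth a (a :: s) (size s)](last_nth a a s) /= => ->.
- move=> i ilt.
  have : affine_on (nth a (a :: s) i) (nth a s i) h; last by [].
  have memS j : (j <= size s)%N -> a <= nth a (a :: s) j <= b.
    case: j => [|j] js /=; first by rewrite lexx ltW.
    have := mem_nth a js; rewrite ms => /orP[/eqP->|]; first by rewrite lexx ltW.
    by case/andP=> _ /andP[/ltW-> /ltW->].
  have lts' j k : (j < k)%N -> (k <= size s)%N ->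
      nth a (a :: s) j < nth a (a :: s) k.
    move=> jk ks; apply: (sorted_ltn_nth lt_trans a st) => //.
    by rewrite inE /= ltnS (leq_trans (ltnW jk)).
  apply: hB.
  + by have /andP[] := memS i (ltnW ilt).
  + exact/ltW/(lts' i i.+1).
  + by have /andP[] := memS i.+1 ilt.
  + move=> x xB; apply/negP => /andP[x1 x2].
    have xs : x \in a :: s.
      rewrite inE ms xB /= (le_lt_trans _ x1) ?(lt_le_trans x2) ?orbT //.
        by have /andP[] := memS i.+1 ilt.
      by have /andP[] := memS i (ltnW ilt).
    have [j js jx] := nthP a xs; rewrite -{x xs xB}jx in x1 x2.
    have [ji|ij] := leqP j i.
      move: ji; rewrite leq_eqVlt => /orP[/eqP ji|ji].
        by move: x1; rewrite ji ltxx.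
      by have := lt_trans x1 (lts' _ _ ji (ltnW ilt)); rewrite ltxx.
    move: ij; rewrite leq_eqVlt => /orP[/eqP ij|ij].
      by move: x2; rewrite -ij /= ltxx.
    have := lts' _ _ ij; rewrite -ltnS => /(_ js) /(lt_trans x2).
    by rewrite ltxx.
Qed.

Lemma breaksD B1 B2 a b h1 h2 : breaks B1 a b h1 -> breaks B2 a b h2 ->
  breaks (B1 ++ B2) a b (fun t => h1 t + h2 t).
Proof.
move=> H1 H2 u v au uv vb hB; apply: affine_onD.
- by apply: H1 => // x xB; apply: hB; rewrite mem_cat xB.
- by apply: H2 => // x xB; apply: hB; rewrite mem_cat xB orbT.
Qed.

Lemma piecewise_affineD a b h1 h2 : a < b ->
  piecewise_affine_int a b h1 -> piecewise_affine_int a b h2 ->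
  piecewise_affine_int a b (fun t => h1 t + h2 t).
Proof.
move=> ab /piecewise_affine_breaks[_ [B1 H1]] /piecewise_affine_breaks[_ [B2 H2]].
exact: breaks_piecewise_affine ab (breaksD H1 H2).
Qed.

Lemma piecewise_affineN a b h : piecewise_affine_int a b h ->
  piecewise_affine_int a b (fun t => - h t).
Proof.
case=> s [ps ls hs]; exists s; split=> // i /hs hk.
exact: (affine_onN hk).
Qed.

Lemma piecewise_affine_rev L h : 0 < L -> piecewise_affine_int 0 L h ->
  piecewise_affine_int 0 L (fun t => h (L - t)).
Proof.
move=> L0 /piecewise_affine_breaks[_ [B HB]].
apply: (@breaks_piecewise_affine [seq L - x | x <- B]) => // u v u0 uv vL hB.
have [||||k hk] := HB (L - v) (L - u); [lra|lra|lra| |].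
  move=> x xB; have := hB (L - x) (map_f _ xB); apply: contraNN => /andP[? ?].
  by apply/andP; split; lra.
exists (- k) => t /andP[t1 t2]; rewrite intrN.
rewrite (hk (L - t)); last by apply/andP; split; lra.
rewrite [in RHS](hk (L - u)); last by apply/andP; split; lra.
ring.
Qed.

Lemma eq_piecewise_affine a b h1 h2 :
  (forall t, a <= t <= b -> h1 t = h2 t) ->
  piecewise_affine_int a b h1 -> piecewise_affine_int a b h2.
Proof.
move=> eqh hp; have [ab _] := piecewise_affine_breaks hp; move: hp.
case=> s [ps ls hs]; exists s; split=> // i ilt.
have lesb : forall j, (j <= size s)%N -> a <= nth a (a :: s) j <= b.
  have st : sorted <%O (a :: s) by [].
  have H := lt_sorted_leq_nth a st.
  move=> j js; have := H 0%N j; rewrite !inE !ltnS js => -> //=.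
  have := H j (size s); rewrite !inE !ltnS leqnn js => /(_ isT isT).
  by rewrite -[nth a (a :: s) (size s)](last_nth a a s) /= ls => ->.
have /andP[i1 i2] := lesb i (ltnW ilt); have /andP[j1 j2] := lesb i.+1 ilt.
have [k hk] := hs i ilt; exists k => t /andP[t1 t2].
rewrite -(eqh t); last by rewrite (le_trans i1) //=; exact: le_trans t2 j2.
by rewrite -(eqh (nth a (a :: s) i)) ?i1 ?i2 // hk ?t1.
Qed.

Definition germ h (k : int) : Prop :=
  \forall s \near (0 : R)^'+, h s = h 0 + k%:~R * s.

Lemma germP h k e : 0 < e -> (forall s, 0 < s < e -> h s = h 0 + k%:~R * s) ->
  germ h k.
Proof.
move=> e0 H; rewrite /germ; near=> s; apply: H; apply/andP; split.
  by near: s; apply: nbhs_right_gt.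
by near: s; apply: nbhs_right_lt.
Unshelve. all: by end_near. Qed.

Lemma germ_inj h k k' : germ h k -> germ h k' -> k = k'.
Proof.
move=> H1 H2; near (0 : R)^'+ => s.
have s0 : 0 < s by near: s; apply: nbhs_right_gt.
have e1 : h s = h 0 + k%:~R * s by near: s; exact: H1.
have e2 : h s = h 0 + k'%:~R * s by near: s; exact: H2.
have : k%:~R * s = k'%:~R * s by apply: (addrI (h 0)); rewrite -e1 -e2.
by move/(mulIf (lt0r_neq0 s0))/eqP; rewrite eqr_int => /eqP.
Unshelve. all: by end_near. Qed.

Lemma slope0E h k : germ h k -> slope0 h = k.
Proof. by move=> hk; apply: xget_unique => // k' /germ_inj; apply. Qed.

Lemma germD h1 h2 k1 k2 : germ h1 k1 -> germ h2 k2 ->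
  germ (fun s => h1 s + h2 s) (k1 + k2).
Proof.
move=> H1 H2; rewrite /germ; near=> s.
have -> : h1 s = h1 0 + k1%:~R * s by near: s; exact: H1.
have -> : h2 s = h2 0 + k2%:~R * s by near: s; exact: H2.
by rewrite intrD; ring.
Unshelve. all: by end_near. Qed.

(** If there is no germ, the dummy value 0 satisfies the bound as well. *)
Lemma slope0_le0 h : (forall s, 0 < s -> h s <= h 0) -> slope0 h <= 0.
Proof.
move=> H; rewrite /slope0; case: xgetP => [k _ hk|//].
near (0 : R)^'+ => s.
have s0 : 0 < s by near: s; apply: nbhs_right_gt.
have e : h s = h 0 + k%:~R * s by near: s; exact: hk.
have := H s s0; rewrite e gerDl pmulr_lle0 //.
by rewrite lerz0.
Unshelve. all: by end_near. Qed.

Lemma affine_germ_right u v h : u < v -> affine_on u v h ->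
  exists k, germ (fun s => h (u + s)) k.
Proof.
move=> uv [k hk]; exists k; apply: (@germP _ _ (v - u)); first lra.
move=> s /andP[s0 sv]; rewrite addr0 hk; last by lra.
by congr (_ + _ * _); ring.
Qed.

Lemma exists_gap_right B t b : t < b ->
  exists2 v, t < v <= b & forall x, x \in B -> ~~ (t < x < v).
Proof.
move=> tb; elim: B => [|c B [v /andP[tv vb] IH]]; first by exists b; rewrite ?tb ?lexx.
have [ct|tc] := leP c t.
  exists v; rewrite ?tv // => x; rewrite inE => /orP[/eqP->|/IH//].
  by rewrite ltNge ct.
exists (Num.min c v); first by rewrite lt_min tc tv ge_min vb orbT.
move=> x; rewrite inE => /orP[/eqP->|/IH].
  by rewrite lt_min ltxx andbF.
by apply: contraNN => /andP[-> ]; rewrite lt_min => /andP[_ ->].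
Qed.

Lemma piecewise_affine_germ_right a b h t : piecewise_affine_int a b h ->
  a <= t < b -> exists k, germ (fun s => h (t + s)) k.
Proof.
move=> /piecewise_affine_breaks[_ [B HB]] /andP[ta tb].
have [v /andP[tv vb] hv] := exists_gap_right B tb.
by apply: (affine_germ_right tv); apply: HB => //; exact: ltW.
Qed.

Lemma piecewise_affine_germ_left L h t : piecewise_affine_int 0 L h ->
  0 < t <= L -> exists k, germ (fun s => h (t - s)) k.
Proof.
move=> hp /andP[t0 tL]; have L0 : 0 < L by lra.
have [|k] := piecewise_affine_germ_right (t := L - t) (piecewise_affine_rev L0 hp).
  by lra.
move=> hk; exists k; move: hk; congr (germ _ k).
by apply/funext => s; congr h; ring.
Qed.

(* The first point of [0, L] at which h reaches M is a break point, reached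
   along an affine piece of positive slope. *)
Lemma first_hit a b h M t0 : piecewise_affine_int a b h ->
  (forall t, a <= t <= b -> h t <= M) -> h a < M -> a <= t0 <= b -> h t0 = M ->
  exists t1, [/\ a < t1 <= t0, h t1 = M & slope0 (fun s => h (t1 - s)) <= -1].
Proof.
case/piecewise_affine_pieces=> s [ps <- hs].
elim: s a ps hs => [|c s IH] a /= ps hs hM haM t0ab ht0.
  by move: haM; rewrite -ht0 (_ : t0 = a) ?ltxx //; lra.
case/andP: ps => ac ps; case: hs => -[k hk] hs.
have cl : c <= last c s.
  by elim: (s) c ps {IH hs hM t0ab ac hk} => //= d s' IH c /andP[/ltW/le_trans cd /IH /cd].
have hcM : h c <= M by apply: hM; rewrite (ltW ac) cl.
have hcE := hk c; rewrite (ltW ac) lexx in hcE; have {}hcE := hcE isT.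
have [t0c|ct0] := leP c t0.
- move: hcM; rewrite le_eqVlt => /orP[/eqP hcM|hcM]; last first.
    have [|||||t1 [/andP[t1a t1b] t1M t1s]] := IH c ps => //.
    + by move=> t /andP[ct tl]; apply: hM; rewrite tl (le_trans (ltW ac)).
    + by rewrite t0c; case/andP: t0ab.
    by exists t1; split=> //; rewrite t1b (lt_trans ac).
  exists c; split=> //; first by rewrite ac t0c.
  have k0 : 0 < k.
    have : 0 < k%:~R * (c - a) by lra.
    by rewrite pmulr_lgt0 ?ltr0z //; lra.
  rewrite (@slope0E _ (- k)); first by lia.
  apply: (@germP _ _ (c - a)); first lra.
  move=> u /andP[u0 uv]; rewrite subr0 hk; last by lra.
  by rewrite hcE intrN; ring.
- exfalso; have /andP[at0 _] := t0ab.
  have e0 := hk t0; rewrite at0 (ltW ct0) in e0; have {}e0 := e0 isT.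
  have : k%:~R * (t0 - a) > 0 by lra.
  have [<-|nat0] := eqVneq a t0; first by rewrite subrr mulr0 ltxx.
  rewrite pmulr_lgt0; last by lra.
  move=> k0; have : k%:~R * (c - a) > k%:~R * (t0 - a) by rewrite ltr_pM2l //; lra.
  lra.
Qed.

Lemma last_hit L h M t0 : 0 < L -> piecewise_affine_int 0 L h ->
  (forall t, 0 <= t <= L -> h t <= M) -> h L < M -> 0 <= t0 <= L -> h t0 = M ->
  exists t1, [/\ t0 <= t1 < L, h t1 = M & slope0 (fun s => h (t1 + s)) <= -1].
Proof.
move=> L0 hp hM hL t0L ht0.
have [||||t1 [/andP[t1a t1b] t1M t1s]] :=
    first_hit (M := M) (t0 := L - t0) (piecewise_affine_rev L0 hp).
- by move=> t tL; apply: hM; lra.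
- by rewrite subr0.
- by lra.
- by rewrite subKr.
exists (L - t1); split=> //; first by lra.
by move: t1s; congr (slope0 _ <= _); apply/funext => s; congr h; ring.
Qed.

Lemma piecewise_affine_max a b h : piecewise_affine_int a b h ->
  exists2 t0, a <= t0 <= b & forall t, a <= t <= b -> h t <= h t0.
Proof.
case/piecewise_affine_pieces=> s [ps <- hs].
elim: s a ps hs => [|c s IH] a /= ps hs.
  by exists a; rewrite ?lexx // => t tl; rewrite (_ : t = a) //; lra.
case/andP: ps => ac ps; case: hs => -[k hk] hs.
have [t1 t1l t1M] := IH c ps hs.
have cl : c <= last c s by case/andP: t1l; exact: le_trans.
have haM t : a <= t <= last c s -> h t <= Num.max (h a) (h t1).
  move=> /andP[at' tl]; rewrite le_max; have [tc|ct] := leP t c; last first.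
    by rewrite (t1M t) ?orbT // (ltW ct) tl.
  rewrite (hk t) ?at' //; have [k0|k0] := leP k 0.
    by rewrite gerDl mulr_le0_ge0 ?lerz0 // subr_ge0.
  apply/orP; right; apply: le_trans (t1M c _); last by rewrite lexx cl.
  by rewrite [in leRHS](hk c) ?(ltW ac) ?lexx // lerD2l ler_pM2l ?ltr0z // lerD2r.
have [le01|lt10] := leP (h a) (h t1).
  exists t1; first by case/andP: t1l => /(le_trans (ltW ac)) -> ->.
  by move=> t /haM; rewrite max_r.
exists a; first by rewrite lexx (le_trans (ltW ac)).
by move=> t /haM; rewrite max_l // ltW.
Qed.

End PiecewiseAffine.

(** * Principal divisors *)

Section PrincipalDivisors.
Variables (R : realType) (G : metric_graph R).
Implicit Types (f : point G -> R) (D E : divisor G).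

Lemma edge_point_inner (x : inner_point G) : edge_point (val x).1 (val x).2 = inr x.
Proof. by rewrite /edge_point -surjective_pairing valK. Qed.

Lemma edge_point_interior (e : edge G) t (h : 0 < t < edge_len e) :
  edge_point e t = inr (exist _ (e, t) h).
Proof. by rewrite /edge_point (insubT (fun x : edge G * R => 0 < x.2 < edge_len x.1)). Qed.

Lemma edge_point0 (e : edge G) : edge_point e 0 = inl (edge_src e).
Proof. by rewrite /edge_point insubF ?lexx //= ltxx. Qed.

Lemma edge_point_len (e : edge G) : edge_point e (edge_len e) = inl (edge_tgt e).
Proof.
by rewrite /edge_point insubF /= ?leNgt ?edge_len_gt0 //= ltxx andbF.
Qed.

Lemma rational_germ_right f (e : edge G) t : rational_function f ->
  0 <= t < edge_len e -> exists k, germ (fun s => f (edge_point e (t + s))) k.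
Proof. by move=> /(_ e) fe; exact: piecewise_affine_germ_right fe. Qed.

Lemma rational_germ_left f (e : edge G) t : rational_function f ->
  0 < t <= edge_len e -> exists k, germ (fun s => f (edge_point e (t - s))) k.
Proof. by move=> /(_ e) fe; exact: piecewise_affine_germ_left fe. Qed.

Lemma rational_germ_src f (e : edge G) : rational_function f ->
  exists k, germ (fun s => f (edge_point e s)) k.
Proof.
move=> rf; have [|k hk] := rational_germ_right (e := e) (t := 0) rf.
  by rewrite lexx edge_len_gt0.
by exists k; move: hk; under eq_fun do rewrite add0r.
Qed.

Lemma rational_germ_tgt f (e : edge G) : rational_function f ->
  exists k, germ (fun s => f (edge_point e (edge_len e - s))) k.
Proof. by move=> rf; apply: rational_germ_left; rewrite ?lexx ?edge_len_gt0. Qed.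

Lemma rationalD f1 f2 : rational_function f1 -> rational_function f2 ->
  rational_function (fun p => f1 p + f2 p).
Proof. by move=> r1 r2 e; apply: piecewise_affineD; rewrite ?edge_len_gt0. Qed.

Lemma rationalN f : rational_function f -> rational_function (fun p => - f p).
Proof. by move=> rf e; apply: piecewise_affineN. Qed.

Lemma div_atD f1 f2 p : rational_function f1 -> rational_function f2 ->
  div_at (fun p => f1 p + f2 p) p = div_at f1 p + div_at f2 p.
Proof.
move=> r1 r2; case: p => [v|[[e t] /= het]] /=.
- rewrite addrACA -!big_split /=; congr (_ + _); apply: eq_bigr => e _.
    have [k1 h1] := rational_germ_src e r1; have [k2 h2] := rational_germ_src e r2.
    by rewrite (slope0E h1) (slope0E h2) (slope0E (germD h1 h2)).
  have [k1 h1] := rational_germ_tgt e r1; have [k2 h2] := rational_germ_tgt e r2.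
  by rewrite (slope0E h1) (slope0E h2) (slope0E (germD h1 h2)).
- rewrite addrACA; case/andP: het => t0 tl; congr (_ + _).
    have ht : 0 <= t < edge_len e by rewrite ltW.
    have [k1 h1] := rational_germ_right r1 ht; have [k2 h2] := rational_germ_right r2 ht.
    by rewrite (slope0E h1) (slope0E h2) (slope0E (germD h1 h2)).
  have ht : 0 < t <= edge_len e by rewrite t0 ltW.
  have [k1 h1] := rational_germ_left r1 ht; have [k2 h2] := rational_germ_left r2 ht.
  by rewrite (slope0E h1) (slope0E h2) (slope0E (germD h1 h2)).
Qed.

Lemma rational_const (c : R) : rational_function (fun _ : point G => c).
Proof.
move=> e; apply: (@breaks_piecewise_affine _ [::]); first exact: edge_len_gt0.
by move=> u v _ _ _ _; exists 0 => t _; rewrite mul0r addr0.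
Qed.

Lemma germ_const (c : R) : germ (fun _ => c) 0.
Proof. by apply: (@germP _ _ _ 1) => // s _; rewrite mul0r addr0. Qed.

Lemma div_at_const (c : R) p : div_at (fun _ : point G => c) p = 0.
Proof.
have s0 := slope0E (germ_const c).
by case: p => [v|[[e t] het]] /=; rewrite ?s0 ?addr0 // !big1 ?addr0.
Qed.

Lemma div_atN f p : rational_function f -> div_at (fun p => - f p) p = - div_at f p.
Proof.
move=> rf; apply/eqP; rewrite -addr_eq0 -div_atD //; last exact: rationalN.
apply/eqP; rewrite -[RHS](div_at_const 0 p); congr div_at.
by apply/funext => q; rewrite addNr.
Qed.

Lemma div_at_le0 f p M : (forall q, f q <= M) -> f p = M -> div_at f p <= 0.
Proof.
have addr_le0 (x y : int) : x <= 0 -> y <= 0 -> x + y <= 0 by lia.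
move=> fM; case: p => [v|[[e t] /= het]] /= fp.
- apply: addr_le0; apply: sumr_le0 => e /eqP ev; apply: slope0_le0 => s _.
    by rewrite edge_point0 ev fp.
  by rewrite subr0 edge_point_len ev fp.
- have fpt : f (edge_point e t) = M by rewrite edge_point_interior.
  by apply: addr_le0; apply: slope0_le0 => s _; rewrite ?addr0 ?subr0 fpt.
Qed.

(** A subgroup, so that equivalences are combined by adding divisors. *)
Definition principal D : Prop :=
  exists2 f, rational_function f & forall p, coeff p D = div_at f p.

Lemma principal0 : principal 0.
Proof.
exists (fun=> 0) => [|p]; first exact: rational_const.
by rewrite coeff0 div_at_const.
Qed.

Lemma principalD D E : principal D -> principal E -> principal (D + E).
Proof.
move=> [f rf hf] [h rh hh]; exists (fun p => f p + h p); first exact: rationalD.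
by move=> p; rewrite coeffD hf hh div_atD.
Qed.

Lemma principalN D : principal D -> principal (- D).
Proof.
move=> [f rf hf]; exists (fun p => - f p); first exact: rationalN.
by move=> p; rewrite coeffN hf div_atN.
Qed.

Lemma principalB D E : principal D -> principal E -> principal (D - E).
Proof. by move=> pD /principalN; apply: principalD. Qed.

Lemma principal_sum (I : Type) (s : seq I) (P : pred I) (F : I -> divisor G) :
  (forall i, P i -> principal (F i)) -> principal (\sum_(i <- s | P i) F i).
Proof. by move=> H; apply: big_ind => //; [exact: principal0|exact: principalD]. Qed.

Lemma principalMz D n : principal D -> principal (D *~ n).
Proof.
move=> pD; have Hn m : principal (D *+ m).
  by elim: m => [|m IH]; rewrite ?mulr0n ?mulrS; [exact: principal0|exact: principalD].
case: n => m; first by rewrite -pmulrn.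
by rewrite NegzE mulrNz -pmulrn; apply: principalN.
Qed.

Lemma lin_equivE D E : lin_equiv D E <-> principal (E - D).
Proof.
split=> -[f rf hf]; exists f => // p.
  by rewrite coeffB hf addrAC subrr add0r.
by rewrite -hf coeffB addrC subrK.
Qed.

Lemma lin_equiv_sym D E : lin_equiv D E -> lin_equiv E D.
Proof. by move=> /lin_equivE /principalN; rewrite opprB => /lin_equivE. Qed.

Lemma lin_equiv_trans D E F : lin_equiv D E -> lin_equiv E F -> lin_equiv D F.
Proof.
move=> /lin_equivE H1 /lin_equivE H2; apply/lin_equivE.
by have := principalD H2 H1; rewrite addrA subrK.
Qed.

Lemma lin_equivB D E F : lin_equiv D E -> lin_equiv (D - F) (E - F).
Proof. by move=> /lin_equivE H; apply/lin_equivE; rewrite opprB addrA subrK. Qed.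

Lemma effectiveP E : effective E <->
  exists s : seq (point G), E = \sum_(p <- s) << p >> /\ deg E = size s.
Proof.
split=> [|[s [-> _]]]; last first.
  apply/fgposP => p; rewrite raddf_sum /= sumr_ge0 // => q _.
  by rewrite coeffU mul1r; case: eqP.
move=> /fgposP Epos.
exists (flatten [seq nseq `|coeff p E|%N p | p <- dom E]).
have eE : E = \sum_(p <- flatten [seq nseq `|coeff p E|%N p | p <- dom E]) << p >>.
  rewrite big_flatten /= big_map -[LHS]freeg_sumE; apply: eq_bigr => p _.
  rewrite big_nseq iter_addr addr0 freegU_muln natz.
  by rewrite gez0_abs.
split=> //; rewrite [in LHS]eE raddf_sum /=.
elim: flatten => [|p s IH]; rewrite ?big_nil ?big_cons //= IH degU.
by rewrite -intS.
Qed.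

Lemma effectiveD D E : effective D -> effective E -> effective (D + E).
Proof.
by move=> /fgposP hD /fgposP hE; apply/fgposP => p; rewrite coeffD addr_ge0.
Qed.

Lemma deg_seq (s : seq (point G)) : deg (\sum_(p <- s) << p >>) = size s.
Proof.
rewrite raddf_sum /=; elim: s => [|p s IH]; rewrite ?big_nil ?big_cons //= IH degU.
by rewrite -intS.
Qed.

Lemma effective_seq (s : seq (point G)) : effective (\sum_(p <- s) << p >>).
Proof. by apply/effectiveP; exists s; rewrite deg_seq. Qed.

End PrincipalDivisors.

(** * Piecewise linear functions on a chain of cycles *)

Section PiecewiseLinear.
Variable R : realType.
Implicit Types (s : seq (int * R)) (c : int) (t : R).

(** The slope is c before all break points, and each pair (n, x) makes it jump by n at x; these
    jumps become the coefficients of the divisor. *)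
Definition ramp_sum s c t : R :=
  c%:~R * t + \sum_(x <- s) x.1%:~R * Num.max 0 (t - x.2).

Lemma ramp_sum_cons x s c t :
  ramp_sum (x :: s) c t = x.1%:~R * Num.max 0 (t - x.2) + ramp_sum s c t.
Proof. by rewrite /ramp_sum big_cons addrCA. Qed.

Lemma ramp_sum_nil c t : ramp_sum [::] c t = c%:~R * t.
Proof. by rewrite /ramp_sum big_nil addr0. Qed.

Lemma ramp_sum_piecewise_affine s c K o a b : a < b ->
  piecewise_affine_int a b (fun t => K + ramp_sum s c (t + o)).
Proof.
move=> ab; elim: s => [|[n x] s IH].
  apply: (@breaks_piecewise_affine _ [::]) => // u v _ _ _ _; exists c => t _.
  by rewrite !ramp_sum_nil; ring.
have -> : (fun t => K + ramp_sum ((n, x) :: s) c (t + o)) =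
    (fun t => n%:~R * Num.max 0 (t + o - x) + (K + ramp_sum s c (t + o))).
  by apply/funext => t; rewrite ramp_sum_cons /=; ring.
apply: piecewise_affineD => //.
apply: (@breaks_piecewise_affine _ [:: x - o]) => // u v au uv vb hB.
have := hB (x - o) (mem_head _ _); rewrite negb_and -!leNgt => /orP[ux|vx].
  exists n => t /andP[ut tv]; rewrite !max_r; first by ring.
  - by lra.
  - by lra.
exists 0 => t /andP[ut tv]; rewrite !max_l; first by ring.
- by lra.
- by lra.
Qed.

Lemma germ_eq (h h' : R -> R) k e : 0 < e -> (forall u, 0 <= u <= e -> h u = h' u) ->
  germ h k -> germ h' k.
Proof.
move=> e0 H hk; rewrite /germ; near=> u.
have u0 : 0 < u by near: u; apply: nbhs_right_gt.
have ue : u <= e by near: u; apply: nbhs_right_le.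
rewrite -!H ?lexx ?ltW ?u0 ?ue //; near: u; exact: hk.
Unshelve. all: by end_near. Qed.

Lemma ramp_sum_germ_right s c K t :
  germ (fun u => K + ramp_sum s c (t + u)) (c + \sum_(x <- s | x.2 <= t) x.1).
Proof.
elim: s => [|[n x] s IH].
  rewrite big_nil addr0; apply: (@germP _ _ _ 1) => // u _.
  by rewrite !ramp_sum_nil; ring.
have -> : (fun u => K + ramp_sum ((n, x) :: s) c (t + u)) =
    (fun u => n%:~R * Num.max 0 (t + u - x) + (K + ramp_sum s c (t + u))).
  by apply/funext => u; rewrite ramp_sum_cons /=; ring.
rewrite big_cons /=; have [xt|tx] := leP x t.
  rewrite addrCA; apply: (germD _ IH); apply: (@germP _ _ _ 1) => // u /andP[u0 _].
  rewrite !max_r; first by ring.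
  - by lra.
  - by lra.
rewrite -[X in germ _ X]add0r; apply: (germD _ IH).
apply: (@germP _ _ _ (x - t)); first by lra.
move=> u /andP[u0 ux]; rewrite !max_l; first by ring.
- by lra.
- by lra.
Qed.

Lemma ramp_sum_germ_left s c K t :
  germ (fun u => K + ramp_sum s c (t - u)) (- (c + \sum_(x <- s | x.2 < t) x.1)).
Proof.
elim: s => [|[n x] s IH].
  rewrite big_nil addr0; apply: (@germP _ _ _ 1) => // u _.
  by rewrite !ramp_sum_nil intrN; ring.
have -> : (fun u => K + ramp_sum ((n, x) :: s) c (t - u)) =
    (fun u => n%:~R * Num.max 0 (t - u - x) + (K + ramp_sum s c (t - u))).
  by apply/funext => u; rewrite ramp_sum_cons /=; ring.
rewrite big_cons /=; have [xt|tx] := ltP x t.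
  rewrite addrCA opprD; apply: (germD _ IH); apply: (@germP _ _ _ (t - x)); first by lra.
  move=> u /andP[u0 ux]; rewrite !max_r; first by rewrite intrN; ring.
  - by lra.
  - by lra.
rewrite -[X in germ _ X]add0r; apply: (germD _ IH).
apply: (@germP _ _ _ 1) => // u /andP[u0 ux]; rewrite !max_l; first by ring.
- by lra.
- by lra.
Qed.

End PiecewiseLinear.

(** * Gluing functions along the chain *)

Section ChainFunctions.
Variables (R : realType) (g : nat) (C : chain_of_cycles R g).
Local Notation G := (chain_graph C).
Local Notation arc := (arc_len C).
Local Notation len := (cycle_len C).

Lemma arc_lt_len i : arc i < len i.
Proof. by have := arc_len_gt0 C i; have := arc_len_shortest C i; lra. Qed.

Section Glue.
Variables (K o : chain_edge g -> R) (s : chain_edge g -> seq (int * R)).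
Variable c : chain_edge g -> int.
Let F (e : chain_edge g) t := K e + ramp_sum (s e) (c e) (t + o e).

(** Each vertex x is the source of exactly one cycle edge, [inl x], on which the value at x is read;
    the hypotheses make all other edge ends agree with it. The offsets [o] let both arcs of a cycle
    read one function. *)
Lemma exists_glued_function :
  (forall e, F e (chain_len C e) = F (inl (chain_tgt e)) 0) ->
  (forall k, F (inr k) 0 = F (inl (bridge_src k, true)) 0) ->
  exists f : point G -> R, [/\ rational_function f,
    forall x : vertex G, div_at f (inl x) =
      \sum_(e | chain_src e == x) (c e + \sum_(y <- s e | y.2 <= o e) y.1) -
      \sum_(e | chain_tgt e == x) (c e + \sum_(y <- s e | y.2 < chain_len C e + o e) y.1)
  & forall x : inner_point G, div_at f (inr x) =
      \sum_(y <- s (val x).1 | y.2 == (val x).2 + o (val x).1) y.1].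
Proof.
move=> Ft Fs.
pose f (p : point G) : R := match p with
  | inl x => F (inl x) 0
  | inr y => F (val y).1 (val y).2
  end.
have Fs' e : F e 0 = F (inl (chain_src e)) 0 by case: e.
have fE (e : edge G) t : 0 <= t <= edge_len e -> F e t = f (edge_point e t).
  move=> /andP[]; rewrite le_eqVlt => /orP[/eqP <- _|t0].
    by rewrite edge_point0; exact: Fs'.
  rewrite le_eqVlt => /orP[/eqP ->|tl]; first by rewrite edge_point_len; exact: Ft.
  by rewrite (edge_point_interior (introT andP (conj t0 tl))).
have rf : rational_function f.
  move=> e; apply: eq_piecewise_affine (fE e) _.
  exact/ramp_sum_piecewise_affine/edge_len_gt0.
have gr (e : edge G) t : 0 <= t < edge_len e ->
    slope0 (fun u => f (edge_point e (t + u))) =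
    c e + \sum_(y <- s e | y.2 <= t + o e) y.1.
  move=> /andP[t0 tl]; apply: slope0E.
  move: (ramp_sum_germ_right (s e) (c e) (K e) (t + o e)).
  apply: (@germ_eq _ _ _ _ (edge_len e - t)); first by rewrite subr_gt0.
  move=> u /andP[u0 ul]; rewrite -fE; last by apply/andP; split; lra.
  by rewrite /F addrAC.
have gl (e : edge G) t : 0 < t <= edge_len e ->
    slope0 (fun u => f (edge_point e (t - u))) =
    - (c e + \sum_(y <- s e | y.2 < t + o e) y.1).
  move=> /andP[t0 tl]; apply: slope0E.
  move: (ramp_sum_germ_left (s e) (c e) (K e) (t + o e)).
  apply: (@germ_eq _ _ _ _ t) => //.
  move=> u /andP[u0 ul]; rewrite -fE; last by apply/andP; split; lra.
  by rewrite /F addrAC.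
exists f; split=> // [x|[[e t] h]].
- rewrite /= -sumrN; congr (_ + _); apply: eq_bigr => e _.
    have := gr e 0; rewrite lexx edge_len_gt0 => /(_ isT).
    by under eq_fun do rewrite add0r; rewrite add0r.
  by apply: gl; rewrite lexx andbT; exact: chain_len_gt0.
- case/andP: (h) => t0 tl.
  have -> : div_at f (inr (exist _ (e, t) h)) =
    slope0 (fun u => f (edge_point e (t + u))) +
    slope0 (fun u => f (edge_point e (t - u))) by [].
  have t0' : 0 <= t < edge_len e by rewrite ltW.
  have tl' : 0 < t <= edge_len e by rewrite t0 ltW.
  rewrite gr // gl //= opprD addrACA subrr add0r.
  rewrite [in X in X - _]big_mkcond [in X in _ - X]big_mkcond [RHS]big_mkcond /=.
  rewrite -sumrB; apply: eq_bigr => y _.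
  by case: ltgtP; rewrite ?subrr ?subr0.
Qed.

End Glue.

End ChainFunctions.

(** * Coordinates on the cycles and elementary equivalences *)

Section AbelJacobi.
Variables (R : realType) (g : nat) (C : chain_of_cycles R g).
Local Notation G := (chain_graph C).
Local Notation arc := (arc_len C).
Local Notation len := (cycle_len C).
Implicit Types (p q : point G) (D E : divisor G) (i j : 'I_g) (t : R).

(* Positions on the i-th cycle are measured from v along the positive
   orientation; the definition is meant for 0 <= t < len i. *)
Definition cycle_point i t : point G :=
  if t < arc i then @edge_point R G (inl (i, false)) t
  else @edge_point R G (inl (i, true)) (t - arc i).

Definition on_bridge p : bool :=
  if p is inr x then if (val x).1 is inr _ then true else false else false.

(* Bridges are contracted to their right end. *)
Definition locate p : 'I_g * R :=
  match p with
  | inl (i, b) => (i, if b then arc i else 0)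
  | inr x => match (val x).1 with
             | inl (i, b) => (i, (val x).2 + if b then arc i else 0)
             | inr k => (bridge_tgt k, 0)
             end
  end.

Lemma len_gt0 i : 0 < len i.
Proof. exact: lt_trans (arc_len_gt0 C i) (arc_lt_len C i). Qed.

Lemma cycle_point0 i : cycle_point i 0 = inl (i, false).
Proof. by rewrite /cycle_point arc_len_gt0 edge_point0. Qed.

Lemma cycle_point_arc i : cycle_point i (arc i) = inl (i, true).
Proof. by rewrite /cycle_point ltxx subrr edge_point0. Qed.

Lemma cycle_point_lt i t (h : 0 < t < arc i) :
  cycle_point i t =
    inr (exist (fun x : edge G * R => 0 < x.2 < edge_len x.1) (inl (i, false), t) h).
Proof.
rewrite /cycle_point; have /andP[_ ->] := h.
exact: (@edge_point_interior R G (inl (i, false)) t h).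
Qed.

Lemma cycle_point_gt i t (h : 0 < t < len i - arc i) :
  cycle_point i (t + arc i) =
    inr (exist (fun x : edge G * R => 0 < x.2 < edge_len x.1) (inl (i, true), t) h).
Proof.
rewrite /cycle_point ltNge lerDr; have /andP[/ltW -> _] := h.
by rewrite addrK; exact: (@edge_point_interior R G (inl (i, true)) t h).
Qed.

Lemma locate_cycle_point i t : 0 <= t < len i -> locate (cycle_point i t) = (i, t).
Proof.
move=> /andP[t0 tl]; have a0 := arc_len_gt0 C i.
have [ta|ta|->] := ltgtP t (arc i); last by rewrite cycle_point_arc.
  move: t0; rewrite le_eqVlt => /orP[/eqP<-|t0]; first by rewrite cycle_point0.
  by rewrite (cycle_point_lt (introT andP (conj t0 ta))) /= addr0.
have h : 0 < t - arc i < len i - arc i by lra.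
by rewrite -[in LHS](subrK (arc i) t) (cycle_point_gt h) /= subrK.
Qed.

Lemma on_bridge_cycle_point i t : 0 <= t < len i -> on_bridge (cycle_point i t) = false.
Proof.
move=> /andP[t0 tl]; have a0 := arc_len_gt0 C i.
have [ta|ta|->] := ltgtP t (arc i); last by rewrite cycle_point_arc.
  move: t0; rewrite le_eqVlt => /orP[/eqP<-|t0]; first by rewrite cycle_point0.
  by rewrite (cycle_point_lt (introT andP (conj t0 ta))).
have h : 0 < t - arc i < len i - arc i by lra.
by rewrite -[in LHS](subrK (arc i) t) (cycle_point_gt h).
Qed.

Lemma locate_range p : 0 <= (locate p).2 < len (locate p).1.
Proof.
case: p => [[i b]|[[[[i b]|k] t] h]] /=.
- by case: b; rewrite ?lexx ?len_gt0 ?arc_lt_len ?(ltW (arc_len_gt0 _ _)).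
- have := arc_lt_len C i; have a0 := arc_len_gt0 C i.
  by case: b h => /= h; lra.
- by rewrite lexx len_gt0.
Qed.

Lemma cycle_point_locate p : ~~ on_bridge p -> cycle_point (locate p).1 (locate p).2 = p.
Proof.
case: p => [[i []]|[[[[i []]|k] t] h]] //= _.
- exact: cycle_point_arc.
- exact: cycle_point0.
- exact: cycle_point_gt.
- by rewrite addr0; exact: cycle_point_lt.
Qed.

Lemma cycle_point_eq i t p : 0 <= t < len i ->
  (cycle_point i t == p) = [&& ~~ on_bridge p, (locate p).1 == i & t == (locate p).2].
Proof.
move=> ht; apply/eqP/idP => [<-|/and3P[nb /eqP <- /eqP ->]].
  by rewrite on_bridge_cycle_point // locate_cycle_point //= !eqxx.
exact: cycle_point_locate.
Qed.

(* The function is a sum of ramps along the circle; the congruence makes it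
   single-valued after one turn. *)
Lemma cycle_principal i (s : seq (int * R)) (c : int) :
  {in s, forall y, 0 <= y.2 < len i} -> \sum_(y <- s) y.1 = 0 ->
  \sum_(y <- s) y.1%:~R * y.2 = c%:~R * len i ->
  principal (\sum_(y <- s) << y.1 *g cycle_point i y.2 >>).
Proof.
move=> sl s0 sc.
pose phi := ramp_sum s c.
have phi0 : phi 0 = 0.
  rewrite /phi /ramp_sum mulr0 add0r big_seq big1 // => y /sl /andP[y0 _].
  by rewrite max_l ?mulr0 //; lra.
have phil : phi (len i) = 0.
  rewrite /phi /ramp_sum -sc -big_split /= big_seq.
  transitivity (\sum_(y <- s | y \in s) y.1%:~R * len i).
    by apply: eq_bigr => y /sl /andP[_ yl]; rewrite max_r; [ring|lra].
  by rewrite -big_seq -mulr_suml -rmorph_sum /= s0 mul0r.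
pose K (e : chain_edge g) : R := match e with
  (* The function vanishes left of cycle i and keeps on its right the value with which it leaves
     through [w]. *)
  | inl (j, _) => if (j <= i)%N then 0 else phi (arc i)
  | inr k => if (k < i)%N then 0 else phi (arc i) end.
pose o (e : chain_edge g) : R :=
  if e is inl (j, true) then if j == i then arc i else 0 else 0.
pose sl' (e : chain_edge g) := if e is inl (j, _) then if j == i then s else [::] else [::].
pose c' (e : chain_edge g) : int := if e is inl (j, _) then if j == i then c else 0 else 0.
have [|k|f [rf fv fi]] := exists_glued_function (C := C) (K := K) (o := o) (s := sl') (c := c').
- case=> [[j b]|k] /=.
    have [->|ji] := eqVneq j i; last by rewrite !ramp_sum_nil !mul0r.
    rewrite leqnn !add0r; case: b => /=; rewrite ?eqxx -/phi ?subrK ?phil ?addr0 ?add0r //.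
  rewrite !ramp_sum_nil mul0r addr0 addr0.
  have [ki|ik] := ltnP k i.
    by case: eqP => _; rewrite ?ramp_sum_nil ?mul0r ?addr0 // -/phi phi0 addr0.
  by rewrite -val_eqE /= gtn_eqF ?ltnS // ramp_sum_nil mul0r addr0.
- rewrite /= !ramp_sum_nil mul0r addr0 -val_eqE /= add0r.
  case: ltngtP => [ki|ik|ki]; rewrite ?eqxx ?ramp_sum_nil ?mul0r ?addr0 ?ltnn //.
  by rewrite add0r.
exists f => // p.
have -> : coeff p (\sum_(y <- s) << y.1 *g cycle_point i y.2 >>) =
    if ~~ on_bridge p && ((locate p).1 == i)
    then \sum_(y <- s | y.2 == (locate p).2) y.1 else 0.
  rewrite raddf_sum /= big_seq.
  transitivity (\sum_(y <- s | y \in s) if [&& ~~ on_bridge p, (locate p).1 == i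
    & y.2 == (locate p).2] then y.1 else 0).
    apply: eq_bigr => y /sl yl; rewrite coeffU cycle_point_eq //.
    by case: ifP; rewrite ?mulr1 ?mulr0.
  rewrite -big_seq; case: (boolP (on_bridge p)) => _ /=; first by rewrite big1.
  by case: eqP => _ /=; [rewrite -big_mkcond|rewrite big1].
have diffsum u : \sum_(y <- s | y.2 <= u) y.1 - \sum_(y <- s | y.2 < u) y.1 =
    \sum_(y <- s | y.2 == u) y.1.
  rewrite [in X in X - _]big_mkcond [in X in _ - X]big_mkcond [RHS]big_mkcond /=.
  by rewrite -sumrB; apply: eq_bigr => y _; case: ltgtP; rewrite ?subrr ?subr0.
case: p => [[j b]|[[e t] h]]; last first.
  rewrite fi; case: e h => [[j b]|k] h /=; last by rewrite big_nil.
  have [->|ji] := eqVneq j i; last by rewrite big_nil.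
  by case: b {h} => /=; rewrite ?eqxx ?addr0.
rewrite fv.
pose S e : int := c' e + \sum_(y <- sl' e | y.2 <= o e) y.1.
pose T e : int := c' e + \sum_(y <- sl' e | y.2 < chain_len C e + o e) y.1.
have S0 e : (if e is inl (j', _) then j' == i else false) = false -> S e = 0.
  by rewrite /S; case: e => [[j' b']|k] /=; [move->|]; rewrite big_nil addr0.
have T0 e : (if e is inl (j', _) then j' == i else false) = false -> T e = 0.
  by rewrite /T; case: e => [[j' b']|k] /=; [move->|]; rewrite big_nil addr0.
rewrite -[X in _ = X - _]/(\sum_(e | chain_src e == (j, b)) S e).
rewrite -[X in _ = _ - X]/(\sum_(e | chain_tgt e == (j, b)) T e).
rewrite (bigD1 (inl (j, b))) //= (bigD1 (P := fun e => chain_tgt e == _) (inl (j, ~~ b))) /=; last first.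
  by rewrite negbK.
rewrite [X in _ = _ + X - _]big1 => [|e]; last first.
  case: e => [[j' b']|k] /andP[/eqP/= He ne]; last exact: S0.
  by move: ne; rewrite He eqxx.
rewrite [X in _ = _ - (_ + X)]big1 => [|e]; last first.
  case: e => [[j' b']|k] /andP[/eqP/= [He1 He2] ne]; last exact: T0.
  by move: ne; rewrite He1 -He2 negbK eqxx.
rewrite !addr0; have [ji|ji] := eqVneq j i; last first.
  by rewrite S0 ?T0 //=; apply/negbTE.
rewrite /S /T /c' /sl' ji eqxx opprD addrACA subrr add0r /o.
case: b => /=; rewrite ?eqxx ?addr0 -?diffsum //.
(* The slope arriving at [v] along the complementary arc has passed every break point; it is [c]
   again because the jumps sum to 0. *)
rewrite subrK; congr (_ - _); transitivity (0 : int).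
  rewrite big_seq_cond big_pred0 // => y.
  by case: (boolP (y \in s)) => // /sl /andP[y0 _] /=; rewrite ltNge y0.
apply: esym; rewrite -[RHS]s0 [RHS]big_seq [RHS]big_mkcond [LHS]big_seq_cond [LHS]big_mkcond /=.
by apply: eq_bigr => y _; case: (boolP (y \in s)) => // /sl /andP[_ ->].
Qed.

(** The function is 0 up to the point, rises with slope 1 to the end of the bridge and is constant
    beyond. *)
Lemma bridge_principal (k : 'I_g.-1) t : 0 <= t < bridge_len C k ->
  principal (<< @edge_point R G (inr k) t >> - << inl (bridge_tgt k, false) >>).
Proof.
move=> /andP[t0 tL].
pose L := bridge_len C k.
pose K (e : chain_edge g) : R := match e with
  | inl (j, _) => if (j <= k)%N then 0 else L - t
  | inr k' => if (k' <= k)%N then 0 else L - t end.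
pose s (e : chain_edge g) : seq (int * R) :=
  if e is inr k' then if k' == k then [:: (1, t)] else [::] else [::].
have [|k'|f [rf fv fi]] :=
    exists_glued_function (C := C) (K := K) (o := fun=> 0) (s := s) (c := fun=> 0).
- case=> [[j b]|k'] /=; rewrite ?ramp_sum_nil ?mul0r //.
  have [->|kk] := eqVneq k' k.
    rewrite leqnn ltnn ramp_sum_cons ramp_sum_nil /= max_r /L; [ring|lra].
  rewrite ramp_sum_nil mul0r; move: kk; rewrite -val_eqE /= => kk.
  by rewrite [in RHS]ltn_neqAle kk.
- rewrite /= ramp_sum_nil; case: eqP => [->|_]; last by rewrite ramp_sum_nil.
  by rewrite ramp_sum_cons ramp_sum_nil /= max_l; [ring|lra].
exists f => // p; rewrite coeffB !coeffU !mul1r.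
case: p => [x|[[e u] h]]; last first.
  rewrite fi [X in _ - X](_ : _ = 0) // subr0 /= addr0.
  case: e h => [e|k'] h /=; rewrite ?big_nil.
    case: eqP => //; rewrite /edge_point; case: insubP => [y _ /= yE|_ //].
    by move=> -[yE']; move: yE; rewrite yE'.
  have [kk|kk] := eqVneq k' k; last first.
    rewrite big_nil; case: eqP => //; rewrite /edge_point; case: insubP => [y _ /= yE|_ //].
    by move=> -[yE']; move: yE kk; rewrite yE' /= => -[->]; rewrite eqxx.
  rewrite big_cons big_nil /=.
  rewrite -kk; have [tu|tu] := eqVneq t u.
    rewrite -tu in h *; rewrite (@edge_point_interior R G (inr k') t h) addr0.
    rewrite (_ : (_ == _) = true) //; apply/eqP; congr inr; exact: val_inj.
  rewrite (_ : (_ == _) = false) //; apply/eqP; rewrite /edge_point.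
  case: insubP => [y _ /= yE|_ //] -[yE']; move: yE; rewrite yE' /= => -[ut].
  by rewrite ut eqxx in tu.
rewrite fv.
pose S e : int := 0 + \sum_(y <- s e | y.2 <= 0) y.1.
pose T e : int := 0 + \sum_(y <- s e | y.2 < chain_len C e + 0) y.1.
have S0 e : e != inr k -> S e = 0.
  rewrite /S; case: e => [e|k'] kk /=; first by rewrite big_nil.
  by rewrite ifF ?big_nil //; apply: contraNF kk => /eqP->.
have T0 e : e != inr k -> T e = 0.
  rewrite /T; case: e => [e|k'] kk /=; first by rewrite big_nil.
  by rewrite ifF ?big_nil //; apply: contraNF kk => /eqP->.
rewrite -[X in _ = X - _]/(\sum_(e | chain_src e == x) S e).
rewrite -[X in _ = _ - X]/(\sum_(e | chain_tgt e == x) T e).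
rewrite [in X in _ = X - _]big_mkcond [in X in _ = _ - X]big_mkcond /=.
rewrite (bigD1 (inr k)) //= [X in _ = _ + X - _]big1 => [|e]; last first.
  by move/S0 ->; case: ifP.
rewrite [X in _ = _ - X](bigD1 (inr k)) //= [X in _ = _ - (_ + X)]big1 => [|e]; last first.
  by move/T0 ->; case: ifP.
rewrite /S /T /s eqxx !addr0 !add0r !big_cons !big_nil /= tL addr0.
congr (_ - _); last first.
  by rewrite -[_ == inl x]/((bridge_tgt k, false) == x); case: eqP.
case: (leP t 0) => t1.
  have -> : t = 0 by lra.
  by rewrite edge_point0 -[_ == inl x]/((bridge_src k, true) == x); case: eqP.
rewrite (@edge_point_interior R G (inr k) t (introT andP (conj t1 tL))) /=.
by case: ifP.
Qed.

End AbelJacobi.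

(** * The Abel-Jacobi map *)

(* Integral divisors form no ring, hence ring is applied coefficientwise. *)
Ltac divisor_ring :=
  apply/eqP/freeg_eqP => ?; rewrite /= ?(coeffD, coeffN, coeff0); ring.

Section AbelJacobiTheorem.
Variables (R : realType) (g : nat) (C : chain_of_cycles R g).
Local Notation G := (chain_graph C).
Local Notation arc := (arc_len C).
Local Notation len := (cycle_len C).
Implicit Types (p q : point G) (D E : divisor G) (i j : 'I_g) (t : R).

(* The retraction of the chain onto its j-th cycle, in the coordinate of
   cycle_point. *)
Definition retract j p : R :=
  if (j < (locate p).1)%N then arc j
  else if j == (locate p).1 then (locate p).2 else 0.

Definition abel_jacobi j D : R :=
  \sum_(p <- dom D) (coeff p D)%:~R * retract j p.

Definition congr_mod (l x y : R) : Prop := exists k : int, x = y + k%:~R * l.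

Lemma congr_mod_refl l x : congr_mod l x x.
Proof. by exists 0; rewrite mul0r addr0. Qed.

Lemma congr_mod_sym l x y : congr_mod l x y -> congr_mod l y x.
Proof. by move=> [k ->]; exists (- k); rewrite intrN; ring. Qed.

Lemma congr_mod_trans l x y z : congr_mod l x y -> congr_mod l y z -> congr_mod l x z.
Proof. by move=> [k ->] [m ->]; exists (k + m); rewrite intrD; ring. Qed.

Lemma congr_modD l x y x' y' : congr_mod l x y -> congr_mod l x' y' ->
  congr_mod l (x + x') (y + y').
Proof. by move=> [k ->] [m ->]; exists (k + m); rewrite intrD; ring. Qed.

Lemma congr_mod_range l x : 0 < l -> exists2 t, 0 <= t < l & congr_mod l x t.
Proof.
move=> l0; exists (x - (Num.floor (x / l))%:~R * l); last first.
  by exists (Num.floor (x / l)); rewrite subrK.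
have /andP[f1 f2] := floor_itv (x / l).
rewrite subr_ge0 -ler_pdivlMr // f1 /= ltrBlDl.
by move: f2; rewrite ltr_pdivrMr // intrD mulrDl mul1r.
Qed.

Lemma retract_range j p : 0 <= retract j p < len j.
Proof.
rewrite /retract; case: ifP => _; first by rewrite arc_lt_len ltW ?arc_len_gt0.
case: eqP => [->|_]; first exact: locate_range.
by rewrite lexx len_gt0.
Qed.

Lemma retract_cycle_point j i t : 0 <= t < len i -> retract j (cycle_point C i t) =
  if (j < i)%N then arc j else if j == i then t else 0.
Proof. by move=> ht; rewrite /retract locate_cycle_point. Qed.

(** Over a common support, additivity becomes a termwise identity. *)
Lemma abel_jacobi_subset (s : seq (point G)) j D : uniq s -> {subset dom D <= s} ->
  abel_jacobi j D = \sum_(p <- s) (coeff p D)%:~R * retract j p.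
Proof.
move=> us sub; rewrite /abel_jacobi [RHS](bigID (mem (dom D))) /=.
rewrite [X in _ = _ + X]big1 ?addr0 => [|p /coeff_outdom ->]; last by rewrite mul0r.
rewrite -[RHS]big_filter; apply: perm_big; apply: uniq_perm; rewrite ?filter_uniq ?uniq_dom //.
by move=> p; rewrite mem_filter andb_idr //; exact: sub.
Qed.

Lemma abel_jacobi_is_additive j : additive (abel_jacobi j).
Proof.
move=> D E.
pose s := undup (dom D ++ dom E ++ dom (D - E)).
rewrite !(@abel_jacobi_subset s) ?undup_uniq // => [|p|p|p].
- by rewrite -sumrB; apply: eq_bigr => p _; rewrite coeffB intrB mulrBl.
- by rewrite mem_undup !mem_cat => ->; rewrite !orbT.
- by rewrite mem_undup !mem_cat => ->.
- by rewrite mem_undup !mem_cat => ->; rewrite !orbT.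
Qed.

HB.instance Definition _ j :=
  GRing.isAdditive.Build (divisor G) R (abel_jacobi j) (abel_jacobi_is_additive j).

Lemma abel_jacobiU j p : abel_jacobi j << p >> = retract j p.
Proof. by rewrite /abel_jacobi domU1 big_seq1 coeffU eqxx mulr1 mul1r. Qed.

Lemma abel_jacobi_seq j (s : seq (point G)) :
  abel_jacobi j (\sum_(p <- s) << p >>) = \sum_(p <- s) retract j p.
Proof. by rewrite raddf_sum; apply: eq_bigr => p _; rewrite /= abel_jacobiU. Qed.

Lemma principal_locate p :
  principal (<< p >> - << cycle_point C (locate p).1 (locate p).2 >>).
Proof.
have [|] := boolP (on_bridge p); last first.
  by move/cycle_point_locate ->; rewrite subrr; exact: principal0.
case: p => [//|[[[//|k] t] h]] _ /=; rewrite cycle_point0.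
have /andP[t0 tl] := h.
have := @bridge_principal _ _ C k t; rewrite ltW //= => /(_ tl).
by rewrite (@edge_point_interior R G (inr k) t h).
Qed.

Let v0 : point G := inl (Ordinal (genus_gt0 C), false).

(** A bridge makes the [v] of a cycle equivalent to the [w] of the preceding one; the differences
    telescope. *)
Lemma principal_v n (h : (n < g)%N) :
  principal (<< inl (Ordinal h, false) >> - << v0 >> -
    \sum_(j < g | (j < n)%N) (<< inl (j, true) >> - << inl (j, false) >>) : divisor G).
Proof.
elim: n h => [|n IH] h.
  rewrite big_pred0 // subr0 (_ : Ordinal h = Ordinal (genus_gt0 C)) ?subrr; last exact: val_inj.
  exact: principal0.
have hn : (n < g)%N by exact: ltnW.
have hk : (n < g.-1)%N by rewrite ltn_predRL.
rewrite (bigD1 (Ordinal hn)) //=.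
rewrite (eq_bigl (fun j : 'I_g => (j < n)%N)) => [|j]; last first.
  by rewrite ltnS andbC -val_eqE /= -ltn_neqAle.
have p1 := IH hn.
have := @bridge_principal _ _ C (Ordinal hk) 0; rewrite lexx bridge_len_gt0 edge_point0 /=.
rewrite (_ : bridge_tgt _ = Ordinal h); last exact: val_inj.
rewrite (_ : bridge_src _ = Ordinal hn); last exact: val_inj.
move=> /(_ isT) p2; have := principalB p1 p2.
set S := \sum_(_ < _ | _) _; set A := << _ >>; set B := << _ >>.
by congr principal; divisor_ring.
Qed.

(** This splits the class of a point into its projections to the single cycles: the Jacobian is a
    product of circles. *)
Lemma principal_retract p : principal (<< p >> - << v0 >> -
    \sum_(j < g) (<< cycle_point C j (retract j p) >> - << inl (j, false) >>)).
Proof.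
have p1 := principal_locate p.
set i := (locate p).1 in p1; have p2 := principal_v (ltn_ord i).
rewrite (_ : Ordinal _ = i) in p2; last exact: val_inj.
have := principalD p1 p2; congr principal.
rewrite [in RHS](bigID (fun j : 'I_g => (j < i)%N)) /=.
rewrite [X in _ = _ - (_ + X)](bigD1 i) ?ltnn //=.
rewrite [X in _ = _ - (_ + (_ + X))]big1 => [|j /andP[ij ji]]; last first.
  by rewrite /retract (negbTE ij) (negbTE ji) cycle_point0 subrr.
rewrite [X in _ = _ - (X + _)](eq_bigr (fun j => << inl (j, true) >> - << inl (j, false) >>))
  => [|j ji]; last by rewrite /retract ji cycle_point_arc.
rewrite /retract ltnn eqxx -/i.
set S := \sum_(_ < _ | _) _; set A := << _ >>; set B := << _ >>; set X := << _ >>.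
divisor_ring.
Qed.

Lemma abel_jacobi_principal D : deg D = 0 ->
  (forall j, congr_mod (len j) (abel_jacobi j D) 0) -> principal D.
Proof.
move=> D0 DJ.
pose n p := coeff p D.
have degE : \sum_(p <- dom D) n p = 0.
  transitivity (deg D) => //; rewrite -[in RHS](freeg_sumE D) raddf_sum /=.
  by apply: eq_bigr => p _; rewrite degU.
have UE p (m : int) : << m *g p >> = << p >> *~ m :> divisor G.
  by rewrite freegU_mulz intz.
have nv0 p : \sum_(q <- dom D) << p >> *~ n q = 0 :> divisor G.
  by rewrite -mulrz_sumr degE.
(* The chips at [v0] and at each [v] cancel because the degree is 0; apart from principal terms, one
   divisor on each cycle remains. *)
have -> : D = \sum_(p <- dom D) (<< p >> - << v0 >> -
    \sum_(j < g) (<< cycle_point C j (retract j p) >> - << inl (j, false) >>)) *~ n p +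
    \sum_(j < g) \sum_(p <- dom D) << n p *g cycle_point C j (retract j p) >>.
  rewrite [X in _ = _ + X]exchange_big /= -big_split /=.
  transitivity (\sum_(p <- dom D) (<< n p *g p >> - << v0 >> *~ n p +
      \sum_(j < g) << inl (j, false) >> *~ n p)).
    rewrite big_split sumrB /= nv0 subr0 [X in _ = _ + X]exchange_big.
    rewrite [X in _ = _ + X]big1 ?addr0 => [|j _]; last by rewrite /= nv0.
    exact: esym (freeg_sumE D).
  apply: eq_bigr => p _; rewrite !mulrzBl UE -!addrA; congr (_ + (_ + _)).
  rewrite mulrz_suml -sumrN -big_split; apply: eq_bigr => j _ /=.
  by rewrite mulrzBl (UE _ (n p)); set X := _ *~ _; set Y := _ *~ _; divisor_ring.
apply: principalD; apply: principal_sum.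
  by move=> p _; exact/principalMz/principal_retract.
move=> j _.
have [c hc] := DJ j; rewrite add0r in hc.
move: degE hc; rewrite /abel_jacobi; move: (dom D) => d dd hc.
have := @cycle_principal _ _ C j [seq (n p, retract j p) | p <- d] c.
rewrite !big_map /=; apply=> //.
by move=> _ /mapP[p _ ->] /=; exact: retract_range.
Qed.

Lemma abel_jacobi_equiv D E : deg D = deg E ->
  (forall j, congr_mod (len j) (abel_jacobi j D) (abel_jacobi j E)) -> lin_equiv D E.
Proof.
move=> dDE DE; apply/lin_equivE; apply: abel_jacobi_principal.
  by rewrite degB dDE subrr.
move=> j; have [k hk] := congr_mod_sym (DE j); exists k.
by rewrite raddfB /= hk; ring.
Qed.

End AbelJacobiTheorem.

(** * Reduced divisors *)

Section MaximumPrinciple.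
Variables (R : realType) (G : metric_graph R) (f : point G -> R) (M : R).
Hypothesis rf : rational_function f.
Hypothesis fM : forall p, f p <= M.
Implicit Types (e : edge G) (t : R).

Let right e t : int := slope0 (fun s => f (edge_point e (t + s))).
Let left e t : int := slope0 (fun s => f (edge_point e (t - s))).

Lemma right_le0 e t : f (edge_point e t) = M -> right e t <= 0.
Proof. by move=> ft; apply: slope0_le0 => s _; rewrite addr0 ft. Qed.

Lemma left_le0 e t : f (edge_point e t) = M -> left e t <= 0.
Proof. by move=> ft; apply: slope0_le0 => s _; rewrite subr0 ft. Qed.

Lemma div_at_interior e t (h : 0 < t < edge_len e) :
  div_at f (edge_point e t) = right e t + left e t.
Proof. by rewrite (edge_point_interior h). Qed.

Lemma div_at_vertex v : div_at f (inl v) =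
  \sum_(e | edge_src e == v) right e 0 + \sum_(e | edge_tgt e == v) left e (edge_len e).
Proof.
rewrite /=; congr (_ + _); apply: eq_bigr => e _.
by rewrite /right; congr slope0; apply/funext => s; rewrite add0r.
Qed.

Lemma sum_right_le0 v : f (inl v) = M -> \sum_(e | edge_src e == v) right e 0 <= 0.
Proof.
by move=> fv; apply: sumr_le0 => e /eqP ev; apply: right_le0; rewrite edge_point0 ev.
Qed.

Lemma sum_left_le0 v : f (inl v) = M ->
  \sum_(e | edge_tgt e == v) left e (edge_len e) <= 0.
Proof.
by move=> fv; apply: sumr_le0 => e /eqP ev; apply: left_le0; rewrite edge_point_len ev.
Qed.

Lemma sum_right_lt0 e : f (inl (edge_src e)) = M -> right e 0 <= -1 ->
  \sum_(e' | edge_src e' == edge_src e) right e' 0 <= -1.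
Proof.
move=> fv re; rewrite (bigD1 e) //= -[leRHS]addr0 lerD // sumr_le0 // => e' /andP[/eqP ev _].
by apply: right_le0; rewrite edge_point0 ev.
Qed.

Lemma sum_left_lt0 e : f (inl (edge_tgt e)) = M -> left e (edge_len e) <= -1 ->
  \sum_(e' | edge_tgt e' == edge_tgt e) left e' (edge_len e') <= -1.
Proof.
move=> fv re; rewrite (bigD1 e) //= -[leRHS]addr0 lerD // sumr_le0 // => e' /andP[/eqP ev _].
by apply: left_le0; rewrite edge_point_len ev.
Qed.

Lemma div_at_right e t : 0 <= t < edge_len e -> f (edge_point e t) = M ->
  right e t <= -1 -> div_at f (edge_point e t) <= -1.
Proof.
move=> /andP[]; rewrite le_eqVlt => /orP[/eqP <- _|t0 tl] ft rt.
  rewrite edge_point0 in ft *; rewrite div_at_vertex.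
  by have := sum_right_lt0 ft rt; have := sum_left_le0 ft; lia.
rewrite div_at_interior ?t0 //.
by have := left_le0 ft; lia.
Qed.

Lemma div_at_left e t : 0 < t <= edge_len e -> f (edge_point e t) = M ->
  left e t <= -1 -> div_at f (edge_point e t) <= -1.
Proof.
move=> /andP[t0]; rewrite le_eqVlt => /orP[/eqP -> |tl] ft rt.
  rewrite edge_point_len in ft *; rewrite div_at_vertex.
  by have := sum_left_lt0 ft rt; have := sum_right_le0 ft; lia.
rewrite div_at_interior ?t0 //.
by have := right_le0 ft; lia.
Qed.

Lemma hit_left e t : f (inl (edge_src e)) < M -> 0 <= t <= edge_len e ->
  f (edge_point e t) = M ->
  exists t1, [/\ 0 < t1 <= t, f (edge_point e t1) = M & left e t1 <= -1].
Proof.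
move=> fs tl ft; apply: (first_hit (h := f \o edge_point e)) tl ft => //=.
by rewrite edge_point0.
Qed.

Lemma hit_right e t : f (inl (edge_tgt e)) < M -> 0 <= t <= edge_len e ->
  f (edge_point e t) = M ->
  exists t1, [/\ t <= t1 < edge_len e, f (edge_point e t1) = M & right e t1 <= -1].
Proof.
move=> fs tl ft; apply: (last_hit (h := f \o edge_point e)) tl ft => //=.
  exact: edge_len_gt0.
by rewrite edge_point_len.
Qed.

End MaximumPrinciple.

Section ReducedDivisors.
Variables (R : realType) (g : nat) (C : chain_of_cycles R g).
Local Notation G := (chain_graph C).
Local Notation arc := (arc_len C).
Local Notation len := (cycle_len C).
Implicit Types (p q : point G) (D E X : divisor G) (i j : 'I_g) (t : R).

(* Up to chips at the last w, these are the divisors reduced at that point. *)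
Inductive one_chip_each : nat -> divisor G -> Prop :=
| one_chip_nil : one_chip_each 0 0
| one_chip_skip n X : one_chip_each n X -> one_chip_each n.+1 X
| one_chip_add i t X : one_chip_each i X -> 0 <= t < len i -> t != arc i ->
    one_chip_each i.+1 (X + << cycle_point C i t >>).

Lemma one_chip_eachP n X : one_chip_each n X ->
  [/\ forall p, coeff p X <= 1,
      forall p, coeff p X != 0 ->
        [/\ ~~ on_bridge p, ((locate p).1 < n)%N & (locate p).2 != arc (locate p).1]
    & forall p q, coeff p X != 0 -> coeff q X != 0 ->
        (locate p).1 = (locate q).1 -> p = q].
Proof.
elim=> [|n' {}X _ [IH1 IH2 IH3]|i t {}X _ [IH1 IH2 IH3] ht ta].
- by split=> [p|p|p q]; rewrite coeff0.
- split=> // p /IH2[nb pn pa]; split=> //; exact: leqW.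
- have new p : cycle_point C i t = p -> coeff p X = 0.
    move=> <-; apply/eqP; apply/negPn; apply/negP => /IH2[].
    by rewrite locate_cycle_point ?ltnn.
  have cE p : coeff p (X + << cycle_point C i t >>) =
      coeff p X + (cycle_point C i t == p)%:R by rewrite coeffD coeffU mul1r.
  split=> [p|p|p q]; rewrite !cE.
  + by have [/new ->|_] := eqVneq (cycle_point C i t) p; rewrite ?add0r ?addr0.
  + have [<- _|_] := eqVneq (cycle_point C i t) p; last first.
      by rewrite addr0 => /IH2[nb /leqW pn pa].
    by rewrite on_bridge_cycle_point // locate_cycle_point.
  + have [<-|_] := eqVneq (cycle_point C i t) p;
      have [<-|_] := eqVneq (cycle_point C i t) q => //; rewrite ?addr0.
    * by move=> _ /IH2[_ + _] e; rewrite -e locate_cycle_point //= ltnn.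
    * by move=> /IH2[_ + _] _ e; rewrite e locate_cycle_point //= ltnn.
    * exact: IH3.
Qed.

Lemma one_chip_each_effective n X : one_chip_each n X -> effective X.
Proof.
elim=> [|//|i t {}X _ IH _ _]; first by apply/fgposP => p; rewrite coeff0.
apply: effectiveD IH _; apply/fgposP => p.
by rewrite coeffU mul1r; case: eqP.
Qed.

Lemma exists_max (f : point G -> R) : rational_function f ->
  exists p, forall q, f q <= f p.
Proof.
move=> rf.
have H (e : edge G) : exists t, forall t', 0 <= t' <= edge_len e ->
    f (edge_point e t') <= f (edge_point e t).
  by have [t _ ht] := piecewise_affine_max (rf e); exists t.
have [m hm] := choice H.
pose e0 : edge G := inl (Ordinal (genus_gt0 C), false).
have [e _ he] := @arg_maxP _ _ _ e0 xpredT (fun e => f (edge_point e (m e))) isT.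
exists (edge_point e (m e)) => -[x|x].
  apply: le_trans (he (inl x) isT).
  have := hm (inl x) 0; rewrite edge_point0; apply.
  by rewrite lexx ltW ?edge_len_gt0.
apply: le_trans (he (val x).1 isT); rewrite -edge_point_inner.
by apply: hm; have /andP[/ltW -> /ltW ->] := valP x.
Qed.

(* If D + div f were effective, let f be maximal exactly on a closed set: each
   slope leaving it consumes a chip of D. The set avoids the last w; going
   left, it avoids each cycle, which would be left in two directions but has one
   chip only, and then the preceding bridge, which has none. *)
Lemma one_chip_each_not_equiv X (c : int) (z : 'I_g) E : one_chip_each g X ->
  c < 0 -> z.+1 = g -> effective E -> ~ lin_equiv (X + << c *g inl (z, true) >>) E.
Proof.
move=> /one_chip_eachP[X1 X2 X3] c0 zg /fgposP E0 [f rf hf].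
have [p0 fM] := exists_max rf; set M := f p0 in fM.
have divX p : - coeff p X - c * (inl (z, true) == p)%:R <= div_at f p.
  have := E0 p; rewrite hf coeffD coeffU; move: (c * _) => u; lia.
have chip p : f p = M -> div_at f p <= -1 -> 1 <= coeff p X.
  by have := divX p; case: eqP => _ /=; lia.
have chip2 p : ~ div_at f p <= -2.
  by have := divX p; have := X1 p; case: eqP => _ /=; lia.
have lt_M p : f p <> M -> f p < M by move=> /eqP; rewrite lt_neqAle fM andbT.
have cyc i : f (inl (i, true)) < M -> forall p, ~~ on_bridge p -> (locate p).1 = i -> f p < M.
  move=> wM.
  have same p q : f p = M -> f q = M -> div_at f p <= -1 -> div_at f q <= -1 ->
      (locate p).1 = (locate q).1 -> p = q.
    by move=> /chip cp /chip cq /cp cp' /cq cq'; apply: X3; lia.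
  have vM : f (inl (i, false)) < M.
    apply: lt_M => vM.
    pose e1 : edge G := inl (i, true); pose e2 : edge G := inl (i, false).
    have [|||t1 [/andP[t10 t1l] ft1 st1]] := hit_left (e := e1) (t := edge_len e1) rf fM => //.
    - by rewrite lexx ltW ?edge_len_gt0.
    - by rewrite edge_point_len.
    have [|||t2 [/andP[t20 t2l] ft2 st2]] := hit_right (e := e2) (t := 0) rf fM => //.
    - by rewrite lexx ltW ?edge_len_gt0.
    - by rewrite edge_point0.
    have d1 : div_at f (edge_point e1 t1) <= -1 by apply: div_at_left ft1 st1; rewrite // t10.
    have d2 : div_at f (edge_point e2 t2) <= -1 by apply: div_at_right ft2 st2; rewrite // t20.
    have := same _ _ ft1 ft2 d1 d2.
    (* The two exits from the maximum are distinct points of one cycle unless both are [v], where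
       their slopes add up to at most -2. *)
    move: t1l t20; rewrite !le_eqVlt => /orP[/eqP et1|t1l] /orP[/eqP et2|t20].
    + move=> _; apply: (chip2 (inl (i, false))); rewrite div_at_vertex.
      have s2 := @sum_right_lt0 _ _ _ _ fM e2.
      have s1 := @sum_left_lt0 _ _ _ _ fM e1.
      move: ft1 ft2 st1 st2 s1 s2; rewrite et1 -et2 edge_point_len edge_point0 => ft1 ft2 st1 st2.
      by move=> /(_ ft1 st1) + /(_ ft2 st2); rewrite /=; lia.
    + rewrite et1 edge_point_len (edge_point_interior (introT andP (conj t20 t2l))) /=.
      by move=> /(_ erefl).
    + rewrite -et2 edge_point0 (edge_point_interior (introT andP (conj t10 t1l))) /=.
      by move=> /(_ erefl).
    + rewrite (edge_point_interior (introT andP (conj t20 t2l))).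
      rewrite (edge_point_interior (introT andP (conj t10 t1l))) /=.
      by move=> /(_ erefl).
  case=> [[j b]|[[[[j b]|//] t] h]] _ /=; first by move=> ->; case: b.
  move=> ji; rewrite {j}ji in h *; apply: lt_M => fp.
  pose e : edge G := inl (i, b).
  have [t0 tl] : 0 < t /\ t < edge_len e by apply/andP.
  have fe : f (edge_point e t) = M by rewrite (@edge_point_interior R G e t h).
  have te : 0 <= t <= edge_len e by rewrite !ltW.
  have [|t1 [/andP[t10 t1l] ft1 st1]] := hit_left rf fM _ te fe; first by rewrite /e /=; case: (b).
  have [|t2 [/andP[t20 t2l] ft2 st2]] := hit_right rf fM _ te fe; first by rewrite /e /=; case: (b).
  have h1 : 0 < t1 < edge_len e by rewrite t10 (le_lt_trans t1l).
  have h2 : 0 < t2 < edge_len e by rewrite t2l (lt_le_trans t0).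
  have d1 : div_at f (edge_point e t1) <= -1.
    by apply: div_at_left ft1 st1; rewrite // t10 (le_trans t1l) // ltW.
  have d2 : div_at f (edge_point e t2) <= -1.
    by apply: div_at_right ft2 st2; rewrite // t2l (le_trans _ t20) // ltW.
  have := same _ _ ft1 ft2 d1 d2.
  rewrite (edge_point_interior h1) (edge_point_interior h2) /= => /(_ erefl) [t12].
  apply: (chip2 (edge_point e t1)); rewrite div_at_interior //.
  by move: st2; rewrite -t12; lia.
have bridge (k : 'I_g.-1) : f (inl (bridge_tgt k, false)) < M ->
    forall t, 0 <= t <= bridge_len C k -> f (@edge_point R G (inr k) t) < M.
  move=> vM t tk; apply: lt_M => ft.
  have [t1 [/andP[t10 t1l] ft1 st1]] := @hit_right _ G _ _ rf fM (inr k) t vM tk ft.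
  have t10' : 0 <= t1 by case/andP: tk => t0 _; exact: le_trans t10.
  have : 1 <= coeff (@edge_point R G (inr k) t1) X.
    by apply: chip => //; apply: div_at_right ft1 st1; rewrite // t10'.
  move=> h1; have : coeff (@edge_point R G (inr k) t1) X != 0 by lia.
  move/X2; move: t10'; rewrite le_eqVlt => /orP[/eqP <-|t1'].
    by rewrite edge_point0 /= eqxx => -[].
  by rewrite (edge_point_interior (introT andP (conj t1' t1l))) => -[].
have wM d i : (i + d = z)%N -> f (inl (i, true)) < M.
  elim: d i => [|d IH] i; first rewrite addn0 => /val_inj ->.
    (* The debt [c] at the last [w], where X has no chip, would force a positive [div_at],
       impossible at a maximum. *)
    apply: lt_M => fz; have := divX (inl (z, true)); rewrite eqxx mulr1.
    have := div_at_le0 fM fz.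
    have [/eqP -> |/X2[_ _ /=]] := boolP (coeff (inl (z, true)) X == 0); last by rewrite eqxx.
    lia.
  move=> idz; have ki : (i < g.-1)%N by lia.
  pose k := Ordinal ki.
  have := IH (bridge_tgt k); rewrite /= addSnnS => /(_ idz) wk.
  have vk : f (inl (bridge_tgt k, false)) < M by exact: cyc wk _ _ _.
  have := bridge k vk 0; rewrite lexx ltW ?bridge_len_gt0 // => /(_ isT).
  by rewrite edge_point0 /= (_ : bridge_src k = i) //; exact: val_inj.
have wM' i : f (inl (i, true)) < M.
  by apply: (wM (z - i)%N); rewrite subnKC // -ltnS zg.
have : f p0 < M; last by rewrite ltxx.
have [|nb] := boolP (on_bridge p0); last exact: cyc (wM' _) _ nb erefl.
case: (p0) => [//|[[[//|k] t] h]] _.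
rewrite -(@edge_point_interior R G (inr k) t h); apply: bridge.
  by have := cyc _ (wM' (bridge_tgt k)) (inl (bridge_tgt k, false)) isT erefl.
by case/andP: h => /ltW -> /ltW ->.
Qed.

End ReducedDivisors.

(** * Particles *)

Definition rank_below (Q : pred nat) (j : nat) : nat := count Q (iota 0 j).

Lemma rank_below0 Q : rank_below Q 0 = 0%N. Proof. by []. Qed.

Lemma rank_belowS Q j : rank_below Q j.+1 = (rank_below Q j + Q j)%N.
Proof. by rewrite /rank_below -addn1 iotaD count_cat /= addn0. Qed.

Lemma rank_belowD Q j d : (rank_below Q j <= rank_below Q (j + d))%N.
Proof.
elim: d => [|d IH]; first by rewrite addn0.
by rewrite addnS rank_belowS (leq_trans IH) ?leq_addr.
Qed.

Lemma rank_below_leq Q : {homo rank_below Q : i j / (i <= j)%N}.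
Proof. by move=> i j ij; rewrite -(subnKC ij) rank_belowD. Qed.

Lemma rank_below_leqD Q j d : (rank_below Q (j + d) <= rank_below Q j + d)%N.
Proof.
elim: d => [|d IH]; first by rewrite !addn0.
by rewrite !addnS rank_belowS; case: (Q _); lia.
Qed.

Section Particles.
Variables (T : nat -> nat -> bool).

(* All particles drift to the right at speed one; a step, counted by [steps], is
   a time at which the particle stays in place. [T] allows steps, and the particle
   immediately behind forbids them. *)
Fixpoint particle (j k : nat) : nat :=
  if j is j'.+1 then
    (particle j' k +
     ~~ (T j' (particle j' k) &&
         ((k == 0) || (particle j' k.-1 + 1 < particle j' k))))%N
  else k.

Definition steps (j k : nat) : nat := (j + k - particle j k)%N.

Lemma particle_ge j k : (k <= particle j k)%N.
Proof. by elim: j => //= j IH; apply: leq_trans IH (leq_addr _ _). Qed.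

Lemma particle_le j k : (particle j k <= j + k)%N.
Proof. by elim: j => //= j IH; case: (~~ _); lia. Qed.

(** A step requires a gap of at least 2, so the order survives when the particle behind moves at the
    same time. *)
Lemma particle_lt j k : (particle j k < particle j k.+1)%N.
Proof.
elim: j => //= j IH; have [Tj|Tj] /= := boolP (T j (particle j k.+1)).
  by have [|] := boolP (_ < _)%N; case: (_ && _) => /=; lia.
by case: (_ && _) => /=; lia.
Qed.

Lemma steps_anti j k e : (steps j (k + e) <= steps j k)%N.
Proof.
elim: e => [|e IH]; first by rewrite addn0.
apply: leq_trans IH; rewrite addnS /steps.
by have := particle_lt j (k + e); lia.
Qed.

(** The gap between consecutive particles is one more than the excess of steps of the one behind;
    exclusion thus becomes a strict inequality between step counts. *)
Lemma stepsS j k :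
  steps j.+1 k = steps j k \/
  [/\ steps j.+1 k = (steps j k).+1, T j (particle j k) &
      forall k', k = k'.+1 -> (steps j k < steps j k')%N].
Proof.
have := particle_le j k; rewrite /steps /=; case: andP => /= [[Tj gap]|_].
  right; split=> //; first by lia.
  by move=> k' kE; subst k; move: gap => /=; have := particle_le j k'; lia.
by left; lia.
Qed.

Variable Q : pred nat.
Hypothesis TQ : forall j z, T j z -> Q j.
Local Notation q := (rank_below Q).

(** Particle k + e exceeds the count [steps j k] only after k, ..., k + e - 1 have done so, each at
    a strictly earlier time of [Q]; so e of these times are lost to it. The subtraction is
    truncated: with at most e such times nothing is gained. *)
Lemma steps_upper j k d e :
  (steps (j + d) (k + e) <= steps j k + ((q (j + d) - q j) - e))%N.
Proof.
elim: d e => [|d IH] e; first by rewrite addn0 (leq_trans (steps_anti _ _ _)) ?leq_addr.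
rewrite addnS rank_belowS; have qD := rank_belowD Q j d.
have [->|[-> /TQ Qj gap]] := stepsS (j + d) (k + e).
  by have := IH e; lia.
rewrite Qj; case: e gap => [|e] gap; first by have := IH 0%N; rewrite addn0; lia.
by have := IH e; have := gap (k + e)%N (addnS _ _); lia.
Qed.

Lemma steps_count j k : (0 < steps j k)%N -> (k + steps j k <= q j)%N.
Proof. by have := steps_upper 0 0 j k; rewrite /= !add0n subn0 => H; lia. Qed.

(* With exactly r + h times available, each particle has to step as early as
   the exclusion rule permits. *)
Lemma steps_forced g r h j k : q g = (r + h)%N -> (h <= steps g r)%N ->
  (j < g)%N -> Q j -> (k <= r)%N -> (k <= q j < k + h)%N ->
  T j (particle j k) /\ (particle j k + q j = j + k + k)%N.
Proof.
move=> qg hs jg Qj kr /andP[kq qk].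
(* The most that k can have done before time j and the least it must have done after it differ by
   one: it steps at j, and its position is determined. *)
have up := steps_upper 0 0 j k; rewrite !add0n rank_below0 subn0 in up.
have {}up : (steps j k <= q j - k)%N by exact: up.
have lo := steps_upper j.+1 k (g - j.+1) (r - k).
rewrite !subnKC // rank_belowS Qj qg /= addn1 in lo.
have := particle_le j k.
have [E|[E Tj _]] := stepsS j k; rewrite E in lo; first by lia.
move=> pj; split=> //; have : (steps j k + particle j k = j + k)%N by rewrite subnK.
lia.
Qed.

End Particles.

(** A discrete intermediate value argument: [q - u] starts at 0, ends at 2 or more and rises by at
    most 1 at a time; a and b are where it first passes above 0 and above 1. *)
Lemma descents (u q : nat -> nat) g : u 0%N = 0%N -> q 0%N = 0%N ->
  (forall j, u j <= u j.+1)%N -> (forall j, q j.+1 <= (q j).+1)%N ->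
  (u g + 2 <= q g)%N ->
  exists a b, [/\ (a < b < g)%N,
    [/\ u a = q a, u a.+1 = u a & q a.+1 = (q a).+1] &
    [/\ (u b).+1 = q b, u b.+1 = u b & q b.+1 = (q b).+1]].
Proof.
move=> u0 q0 um qm ug.
have cross m : (u g + m < q g)%N -> exists a, [/\ (a < g)%N,
    [/\ (u a + m = q a)%N, u a.+1 = u a & q a.+1 = (q a).+1] &
    forall j, (u j + m < q j)%N -> (a < j)%N].
  move=> ugm; have ex : exists j, (u j + m < q j)%N by exists g.
  case: (ex_minnP ex) => [[|a]] ha amin; first by lia.
  exists a; split=> //; first exact: amin.
  have na : ~~ (u a + m < q a)%N by apply/negP => /amin; rewrite ltnn.
  by have := um a; have := qm a; split; lia.
have [|a [ag [a1 a2 a3] amin]] := cross 0%N; first by lia.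
have [|b [bg [b1 b2 b3] _]] := cross 1%N; first by lia.
exists a, b; split; [|split; lia|split; lia].
by rewrite bg andbT; apply: amin; lia.
Qed.

Lemma exists_subset_of_size (W : pred nat) g m a b : (a < b < g)%N -> W a -> W b ->
  (2 <= m <= rank_below W g)%N ->
  exists Q : pred nat, [/\ forall i, Q i -> W i, Q a, Q b & rank_below Q g = m].
Proof.
move=> abg Wa Wb /andP[m2 mW].
have [d dE] : exists d, (rank_below W g = m + d)%N.
  by exists (rank_below W g - m)%N; rewrite subnKC.
elim: d W Wa Wb dE {mW} => [|d IH] W Wa Wb dE; first by exists W; rewrite addn0 in dE.
have [x [xg xa xb Wx]] : exists x, [/\ (x < g)%N, x != a, x != b & W x].
  have [/hasP[x]|/hasPn none] :=
      boolP (has (fun x => [&& x != a, x != b & W x]) (iota 0 g)).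
    by rewrite mem_iota => /andP[_ xg] /and3P[? ? ?]; exists x.
  have : (rank_below W g <= rank_below (pred2 a b) g)%N.
    rewrite /rank_below -!size_filter.
    apply: uniq_leq_size; first by rewrite filter_uniq ?iota_uniq.
    move=> x; rewrite !mem_filter => /andP[Wx xi]; rewrite xi andbT /=.
    by have := none x xi; rewrite Wx andbT negb_and !negbK.
  have : (rank_below (pred2 a b) g <= 2)%N.
    rewrite /rank_below -size_filter -[2%N]/(size [:: a; b]).
    apply: uniq_leq_size; first by rewrite filter_uniq ?iota_uniq.
    by move=> x; rewrite mem_filter => /andP[]; rewrite !inE.
  lia.
have cnt : (rank_below W g = (rank_below (fun i => W i && (i != x)) g).+1)%N.
  have split s : count W s = (count_mem x s + count (fun i => W i && (i != x)) s)%N.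
    elim: s => //= y s ->; have [->|yx] := eqVneq y x; first by rewrite Wx ?eqxx /=; lia.
    by case: (W y); rewrite ?yx /=; lia.
  by rewrite /rank_below split count_uniq_mem ?iota_uniq // mem_iota xg.
have [|||Q [QW Qa Qb Qm]] := IH (fun i => W i && (i != x)).
- by rewrite /= Wa eq_sym.
- by rewrite /= Wb eq_sym.
- by have := cnt; lia.
by exists Q; split=> // i /QW /andP[].
Qed.

(** * Bounding the rank *)

Section Rank.
Variables (R : realType) (g : nat) (C : chain_of_cycles R g).
Local Notation G := (chain_graph C).
Local Notation arc := (arc_len C).
Local Notation len := (cycle_len C).
Local Notation AJ := (abel_jacobi (C := C)).
Implicit Types (p q : point G) (D E X : divisor G) (i j : 'I_g) (t : R).

Lemma abel_jacobi_addU j D i t : 0 <= t < len i ->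
  AJ j (D + << cycle_point C i t >>) =
  AJ j D + (if (j < i)%N then arc j else if j == i then t else 0).
Proof. by move=> ht; rewrite raddfD /= abel_jacobiU retract_cycle_point. Qed.

Lemma v_range i : 0 <= (0 : R) < len i. Proof. by rewrite lexx len_gt0. Qed.

Lemma w_range i : 0 <= arc i < len i.
Proof. by rewrite arc_lt_len ltW ?arc_len_gt0. Qed.

(** This is the coordinate of a divisor of degree d with z chips left of cycle j and the others
    right of it: the former retract to [v], at 0, the latter to [w]. *)
Definition trivial_at D (d : int) (j z : nat) : bool :=
  if insub j is Some i
  then `[< congr_mod (len i) (AJ i D) ((d - z%:Z)%:~R * arc i) >] else false.

Lemma trivial_atE D d i z : trivial_at D d i z ->
  congr_mod (len i) (AJ i D) ((d - z%:Z)%:~R * arc i).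
Proof. by rewrite /trivial_at valK => /asboolP. Qed.

(* When particle k is blocked at time n, the divisor built for k - 1 is used
   together with one more chip to subtract, at w on the n-th cycle: the class on
   that cycle is then no longer trivial. *)
Lemma adversary D d n k : (n <= g)%N ->
  let z := particle (trivial_at D d) n k in
  exists E X, [/\ effective E, deg E = k, one_chip_each (C := C) n X,
    deg X = z%:Z - k%:Z &
    (forall i, (i < n)%N -> congr_mod (len i) (AJ i D)
        (AJ i E + AJ i X + (d - z%:Z)%:~R * arc i)) /\
    (forall i, (n <= i)%N -> AJ i E = 0 /\ AJ i X = 0)].
Proof.
elim: n k => [|n IH] k ng /=.
  pose v0 := cycle_point C (Ordinal (genus_gt0 C)) 0.
  (* All k chips start at the first [v], which every retraction sends to 0; this matches the initial
     position k. *)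
  exists (\sum_(p <- nseq k v0) << p >>), 0; split.
  - exact: effective_seq.
  - by rewrite deg_seq size_nseq.
  - exact: one_chip_nil.
  - by rewrite deg0 subrr.
  split=> // i _; rewrite raddf0 abel_jacobi_seq big_nseq; split=> //.
  rewrite retract_cycle_point ?v_range // if_same.
  by elim: k => //= k ->; rewrite addr0.
pose i0 := Ordinal ng.
have i0P i : (i < n.+1)%N -> (i < n)%N \/ i = i0.
  by rewrite ltnS leq_eqVlt => /orP[/eqP H|]; [right; exact: val_inj|left].
set T := trivial_at D d; pose z := particle T n k; rewrite -/z.
have [Tz|nTz] /= := boolP (T n z); last first.
  have [E [X [E0 Ek X1 Xz [AJlt AJge]]]] := IH k (ltnW ng).
  have [t ht tE] := congr_mod_range (AJ i0 D - (d - (z + 1)%:Z)%:~R * arc i0) (len_gt0 C i0).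
  (* A chip at [w] could be passed to the right, leaving the cycle empty: [T] would hold. *)
  have ta : t != arc i0.
    apply: contraNneq nTz => ta; rewrite /T /trivial_at (insubT (fun m => m < g)%N ng).
    apply/asboolP; rewrite -/i0; rewrite ta in tE.
    have := congr_modD tE (congr_mod_refl (len i0) ((d - (z + 1)%:Z)%:~R * arc i0)).
    rewrite subrK PoszD !intrB intrD; congr congr_mod.
    ring.
  exists E, (X + << cycle_point C i0 t >>); split=> //.
  - exact: (@one_chip_add _ _ C i0 t X X1 ht ta).
  - by rewrite degD degU Xz PoszD -/T -/z; lia.
  split=> i hi; rewrite abel_jacobi_addU //.
    have [iln|->] := i0P _ hi.
      rewrite iln; have := AJlt i iln; rewrite -/T -/z; congr congr_mod.
      by rewrite PoszD !intrB intrD; ring.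
    rewrite ltnn eqxx; have [-> ->] := AJge i0 (leqnn _); rewrite !add0r.
    have := congr_modD tE (congr_mod_refl (len i0) ((d - (z + 1)%:Z)%:~R * arc i0)).
    by rewrite subrK.
  have [-> ->] := AJge i (ltnW hi); rewrite ltnNge (ltnW hi) /= add0r.
  by rewrite -val_eqE /= gtn_eqF.
have {}Tz : congr_mod (len i0) (AJ i0 D) ((d - z%:Z)%:~R * arc i0).
  exact: (@trivial_atE D d i0 z Tz).
have [free|] /= := boolP ((k == 0%N) || (particle T n k.-1 + 1 < z)%N).
  have [E [X [E0 Ek X1 Xz [AJlt AJge]]]] := IH k (ltnW ng).
  exists E, X; rewrite addn0; split=> //; first exact: one_chip_skip.
  split=> i hi; last by apply: AJge; exact: ltnW.
  have [iln|->] := i0P _ hi; first exact: AJlt.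
  by have [-> ->] := AJge i0 (leqnn _); rewrite !add0r.
rewrite negb_or => /andP[k0]; rewrite -leqNgt => zle.
have [E [X [E0 Ek X1 Xz [AJlt AJge]]]] := IH k.-1 (ltnW ng).
have zE : (particle T n k.-1).+1 = z.
  by have := particle_lt T n k.-1; rewrite prednK ?lt0n // -/z; lia.
(* Subtracting [w] shifts a trivial coordinate by one arc, so the chip of the reduced divisor lands
   at [v]. *)
exists (E + << cycle_point C i0 (arc i0) >>), (X + << cycle_point C i0 0 >>); split.
- apply: effectiveD => //; apply/fgposP => p.
  by rewrite coeffU mul1r; case: eqP.
- by rewrite degD degU Ek; lia.
- by apply: (@one_chip_add _ _ C i0 0 X X1); rewrite ?v_range // lt_eqF ?arc_len_gt0.
- by rewrite degD degU Xz -/T; lia.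
split=> i hi; rewrite !abel_jacobi_addU ?v_range ?w_range //.
  have [iln|->] := i0P _ hi.
    rewrite iln; have := AJlt i iln; rewrite -/T; congr congr_mod.
    by rewrite -zE -addn1 !PoszD !intrB !intrD; ring.
  rewrite ltnn eqxx; have [-> ->] := AJge i0 (leqnn _); rewrite !add0r addr0.
  move: Tz; congr congr_mod; rewrite PoszD !intrB !intrD; ring.
have [-> ->] := AJge i (ltnW hi); rewrite ltnNge (ltnW hi) /=.
by rewrite -val_eqE /= gtn_eqF // !addr0.
Qed.

Let z0 : 'I_g := Ordinal (eq_ind _ (fun m => (g.-1 < m)%N) (leqnn _) _ (prednK (genus_gt0 C))).
Let w0 : point G := inl (z0, true).

Lemma abel_jacobi_w0 j (c : int) : AJ j << c *g w0 >> = c%:~R * arc j.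
Proof.
have -> : << c *g w0 >> = << w0 >> *~ c :> divisor G by rewrite freegU_mulz intz.
rewrite raddfMz /= abel_jacobiU mulrzl /retract /=; congr (_ *~ _).
case: ltnP => // jz; case: eqP => [->//|[]]; apply: val_inj => /=.
by have := ltn_ord j; move: jz => /=; lia.
Qed.

(** The d - z chips not spent in the sweep, possibly a debt, end up at the last [w]. *)
Lemma lin_equiv_reduced D d k E X : let z := particle (trivial_at D d) g k in
  deg D = d -> deg E = k -> deg X = z%:Z - k%:Z ->
  (forall i, congr_mod (len i) (AJ i D) (AJ i E + AJ i X + (d - z%:Z)%:~R * arc i)) ->
  lin_equiv (D - E) (X + << (d - z%:Z) *g w0 >>).
Proof.
move=> z Dd Ek Xz H; apply: abel_jacobi_equiv => [|j].
  by rewrite degB degD degU Dd Ek Xz; lia.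
rewrite raddfB raddfD /= abel_jacobi_w0.
have := congr_modD (H j) (congr_mod_refl (len j) (- AJ j E)); congr congr_mod.
ring.
Qed.

Lemma reduced_form D : exists X c, [/\ one_chip_each (C := C) g X,
  lin_equiv D (X + << c *g w0 >>) & deg X + c = deg D].
Proof.
have [E [X [E0 E1 X1 Xz [H _]]]] := adversary D (deg D) 0 (leqnn g).
have {}E0 := fgpos_eq0P E0 E1.
exists X, (deg D - (particle (trivial_at D (deg D)) g 0)%:Z); split=> //.
  rewrite -[D in lin_equiv D _]subr0 -E0; apply: (lin_equiv_reduced (k := 0)) => //.
  by move=> i; apply: H.
by rewrite Xz; lia.
Qed.

(** The reduced representative has the degree of D by construction, and an effective divisor in the
    class excludes a debt at the last [w]. *)
Lemma equiv_effective_deg D E : effective E -> lin_equiv D E ->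
  exists E', [/\ effective E', lin_equiv D E' & deg E' = deg D].
Proof.
move=> E0 DE; have [X [c [X1 DX dX]]] := reduced_form D.
exists (X + << c *g w0 >>); split=> //; last by rewrite degD degU.
apply: effectiveD (one_chip_each_effective X1) _.
have c0 : 0 <= c.
  rewrite leNgt; apply/negP => c0.
  apply: (one_chip_each_not_equiv X1 c0 (z := z0) _ E0) => /=.
    exact: prednK (genus_gt0 C).
  exact: lin_equiv_trans (lin_equiv_sym DX) DE.
by apply/fgposP => p; rewrite coeffU mulr_ge0 //; case: eqP.
Qed.

Definition rank_ge (r : nat) D : Prop :=
  forall E, effective E -> deg E = r ->
    exists2 E', effective E' & lin_equiv (D - E) E'.

(** Beyond the degree, the adversary's E would leave a reduced divisor in debt at the last [w]. *)
Lemma particle_bound D r : rank_ge r D ->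
  (particle (trivial_at D (deg D)) g r)%:Z <= deg D.
Proof.
move=> rD.
have [E [X [E0 E1 X1 Xz [H _]]]] := adversary D (deg D) r (leqnn g).
have [E' E'0 DE'] := rD E E0 E1.
rewrite leNgt -subr_lt0; apply/negP => c0.
apply: (one_chip_each_not_equiv X1 c0 (z := z0) _ E'0) => /=.
  exact: prednK (genus_gt0 C).
apply: lin_equiv_trans (lin_equiv_sym _) DE'.
by apply: (lin_equiv_reduced (k := r)) => // i; exact: H.
Qed.

Lemma rank_ge_deg D r : rank_ge r D -> r%:Z <= deg D.
Proof.
by move=> /particle_bound; apply: le_trans; rewrite lez_nat particle_ge.
Qed.

Let nw0 m : divisor G := \sum_(p <- nseq m w0) << p >>.

Lemma rank_ge_leq D r m : (r <= m)%N -> rank_ge m D -> rank_ge r D.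
Proof.
move=> rm mD E E0 Er.
have [||E' E'0 DE'] := mD (E + nw0 (m - r)).
- exact: effectiveD E0 (effective_seq _).
- by rewrite degD deg_seq size_nseq Er -PoszD subnKC.
exists (E' + nw0 (m - r)); first exact: effectiveD (effective_seq _).
move: DE' => /lin_equivE DE'; apply/lin_equivE; move: DE'; congr principal.
set N := nw0 _; divisor_ring.
Qed.

Lemma largestP (P : set nat) N m : P m -> (forall n, P n -> (n <= N)%N) ->
  P (largest P) /\ forall n, P n -> (n <= largest P)%N.
Proof.
move=> Pm PN; rewrite /largest; case: xgetP => [n _ []//|none]; exfalso.
have ex : exists n, `[< P n >] by exists m; apply/asboolP.
have bnd n : `[< P n >] -> (n <= N)%N by move=> /asboolP/PN.
have [n /asboolP Pn nmax] := ex_maxnP ex bnd.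
by apply: (none n); split=> // k Pk; apply/nmax/asboolP.
Qed.

Lemma rankP D r : (r%:Z <= rank D) <-> rank_ge r D.
Proof.
pose P := [set m : nat | forall E : divisor G, effective E -> deg E = Posz m ->
      exists D', [/\ effective D', lin_equiv D D' & effective (D' - E)]].
have PE m : P m <-> rank_ge m D.
  split=> H E E0 Em.
    by have [D' [D'0 DD' D'E]] := H E E0 Em; exists (D' - E) => //; exact: lin_equivB.
  have [E' E'0 DE'] := H E E0 Em; exists (E' + E); split.
  - exact: effectiveD.
  - move: DE' => /lin_equivE DE'; apply/lin_equivE; move: DE'; congr principal.
    divisor_ring.
  - by rewrite addrK.
(* [largest] is a true maximum only on a bounded set; the degree bounds this one. *)
have bnd m : P m -> (m <= `|deg D|)%N by move=> /PE/rank_ge_deg; lia.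
rewrite /rank; case: asboolP => [[D' DD' D'0]|none].
  have P0 : P 0%N.
    by move=> E E0 E1; exists D'; rewrite (fgpos_eq0P E0 E1) subr0.
  have [Pl lmax] := largestP P0 bnd; rewrite lez_nat; split.
    by move=> /rank_ge_leq; apply; apply/PE.
  by move=> /PE; exact: lmax.
split=> [//|rD]; exfalso; apply: none.
have [||E' E'0 DE'] := rD (nw0 r).
- exact: effective_seq.
- by rewrite deg_seq size_nseq.
exists (E' + nw0 r); last exact: effectiveD (effective_seq _).
move: DE' => /lin_equivE DE'; apply/lin_equivE; move: DE'; congr principal.
set N := nw0 _; divisor_ring.
Qed.

Definition covers (r : nat) (d : int) (w : nat) : Prop :=
  forall E, effective E -> deg E = Posz (w + r) ->
    exists D, [/\ effective D, deg D = d, Posz r <= rank D & effective (D - E)].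

Lemma brill_noether_rankP r d w : (forall m, covers r d m -> (m <= w)%N) ->
  brill_noether_rank G r d = w <-> covers r d w.
Proof.
move=> bnd; rewrite /brill_noether_rank; case: asboolP => [[D [Dd rD]]|none].
  have P0 : covers r d 0.
    move=> E E0 Er; move/rankP: rD => rD.
    have [E' E'0 DE'] := rD E E0 Er.
    have {E' E'0 DE'} [E' [E'0 DE' dE']] := equiv_effective_deg E'0 DE'.
    exists (E' + E); split; [exact: effectiveD| | |by rewrite addrK].
      by rewrite degD dE' degB subrK.
    apply/rankP => F F0 Fr; have [F' F'0 DF'] := rD F F0 Fr; exists F' => //.
    apply: lin_equiv_trans DF'; apply: lin_equivB; apply: lin_equiv_sym.
    move: DE' => /lin_equivE DE'; apply/lin_equivE; move: DE'; congr principal.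
    divisor_ring.
  have [Pl lmax] := largestP P0 bnd; split=> [[<-]//|Pw].
  by congr Posz; apply/eqP; rewrite eqn_leq lmax // bnd.
split=> [//|Pw]; exfalso; apply: none.
have [||D [D0 Dd rD _]] := Pw (nw0 (w + r)).
- exact: effective_seq.
- by rewrite deg_seq size_nseq.
by exists D.
Qed.

End Rank.

(** * Chips on distinct cycles *)

Section Chips.
Variables (R : realType) (g : nat) (C : chain_of_cycles R g).
Local Notation G := (chain_graph C).
Local Notation arc := (arc_len C).
Local Notation len := (cycle_len C).
Local Notation AJ := (abel_jacobi (C := C)).
Implicit Types (p q : point G) (D E X : divisor G) (i j : 'I_g) (t : R).
Implicit Types (s : seq (point G)).

Definition chips_below s (j : nat) : nat := count (fun p => (locate p).1 < j)%N s.

Lemma chips_below0 s : chips_below s 0 = 0%N.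
Proof. by rewrite /chips_below (eq_count (a2 := pred0)) ?count_pred0. Qed.

Lemma chips_belowS s (j : nat) : (chips_below s j.+1 =
  chips_below s j + count (fun p => (locate p).1 == j :> nat) s)%N.
Proof. by elim: s => //= p s ->; case: ltngtP; lia. Qed.

Lemma chips_below_all s : chips_below s g = size s.
Proof. by rewrite /chips_below -(count_predT s); apply: eq_count => p; exact: ltn_ord. Qed.

Lemma abel_jacobi_empty_cycle i s :
  count (fun p => (locate p).1 == i :> nat) s = 0%N ->
  AJ i (\sum_(p <- s) << p >>) =
    ((size s)%:Z - (chips_below s i)%:Z)%:~R * arc i.
Proof.
rewrite abel_jacobi_seq; elim: s => [|p s IH] /=.
  by rewrite big_nil subrr mul0r.
move=> /eqP; rewrite addn_eq0 => /andP[/eqP c0 /eqP c1]; rewrite big_cons IH //.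
rewrite /retract; have : (locate p).1 != i :> nat by apply/negP => ce; rewrite ce in c0.
rewrite [i == _]eq_sym -val_eqE /= => /negbTE ->; rewrite /chips_below /=.
case: ltngtP => [ip|pi|] /=; rewrite ?add0n ?add0r.
- by rewrite [(size s).+1%:Z]intS !intrB intrD; ring.
- by rewrite [(size s).+1%:Z]intS [(1 + _)%:Z]intS !intrB !intrD; ring.
- by move=> e; move: c0; rewrite e eqxx.
Qed.

Definition chips (b : pred nat) (th : 'I_g -> R) : divisor G :=
  \sum_(i < g | b i) << cycle_point C i (th i) >>.

Lemma sum_rank_below (b : pred nat) n : (\sum_(i < n | b i) 1)%N = rank_below b n.
Proof.
by rewrite -(big_mkord b (fun=> 1%N)) /rank_below -sum1_count /index_iota subn0.
Qed.

Lemma deg_chips b th : deg (chips b th) = rank_below b g.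
Proof.
rewrite raddf_sum /= -sum_rank_below -[RHS]natz natr_sum.
by apply: eq_bigr => i _; rewrite degU.
Qed.

Lemma chips_effective b th : effective (chips b th).
Proof.
apply/fgposP => p; rewrite raddf_sum /= sumr_ge0 // => i _.
by rewrite coeffU mul1r; case: eqP.
Qed.

Lemma abel_jacobi_chips b th i : (forall j, 0 <= th j < len j) ->
  AJ i (chips b th) = (if b i then th i else 0) +
    ((rank_below b g)%:Z - (rank_below b i.+1)%:Z)%:~R * arc i.
Proof.
move=> hth; rewrite raddf_sum /=.
have -> : (rank_below b g)%:Z - (rank_below b i.+1)%:Z =
    (\sum_(j < g | b j && (i < j)) 1)%N%:Z.
  rewrite -(sum_rank_below b g) (bigID (fun j : 'I_g => (j < i.+1)%N)) /=.
  rewrite -(big_ord_widen_cond g b (fun=> 1%N) (ltn_ord i)) sum_rank_below PoszD.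
  rewrite addrAC subrr add0r; congr Posz; apply: eq_bigl => j.
  by rewrite ltnS -ltnNge.
transitivity ((if b i then th i else 0) + \sum_(j < g | b j && (i < j)%N) arc i); last first.
  by rewrite big_const -sum1_card iter_addr addr0 -pmulrn mulr_natl.
rewrite [LHS](bigID (fun j : 'I_g => (i < j)%N)) /= addrC; congr (_ + _); last first.
  by apply: eq_bigr => j /andP[_ ij]; rewrite abel_jacobiU retract_cycle_point ?ij.
case: ifP => bi; last first.
  apply: big1 => j /andP[bj ij]; rewrite abel_jacobiU retract_cycle_point // (negbTE ij).
  by case: eqP bj => // <-; rewrite bi.
rewrite (bigD1 i) ?bi ?ltnn //= abel_jacobiU retract_cycle_point // ltnn eqxx.
rewrite big1 ?addr0 // => j /andP[/andP[bj ij] ji].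
by rewrite abel_jacobiU retract_cycle_point // (negbTE ij) eq_sym (negbTE ji).
Qed.

Lemma exists_angles (x : 'I_g -> R) :
  exists th : 'I_g -> R, forall i, 0 <= th i < len i /\ congr_mod (len i) (th i) (x i).
Proof.
have H i : exists t, 0 <= t < len i /\ congr_mod (len i) t (x i).
  have [t t1 t2] := congr_mod_range (x i) (len_gt0 C i).
  by exists t; split=> //; exact: congr_mod_sym.
by have [th hth] := choice H; exists th.
Qed.

(* The condition says that D is equivalent to one chip on each cycle other than
   a and b. *)
Lemma equiv_chips D (a b : 'I_g) : (a < b)%N -> deg D = g%:Z - 2 ->
  congr_mod (len a) (AJ a D) ((g%:Z - 2 - a%:Z)%:~R * arc a) ->
  congr_mod (len b) (AJ b D) ((g%:Z - 1 - b%:Z)%:~R * arc b) ->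
  exists2 E, effective E & lin_equiv D E.
Proof.
move=> ab dD Da Db.
pose W (i : nat) := (i != a :> nat) && (i != b :> nat).
have WE n : (rank_below W n + (a < n) + (b < n) = n)%N.
  elim: n => // n IH; rewrite rank_belowS {2}/W !ltnS.
  by move: IH; case: (ltngtP n a) => ?; case: (ltngtP n b) => ? /=; lia.
pose m i := ((rank_below W g)%:Z - (rank_below W i.+1)%:Z)%:~R * arc i.
have [th hth] := exists_angles (fun i => AJ i D - m i).
exists (chips W th); first exact: chips_effective.
apply: abel_jacobi_equiv => [|i].
  by rewrite dD deg_chips; have := WE g; rewrite !ltn_ord; lia.
rewrite abel_jacobi_chips => [|j]; last by case: (hth j).
have WG : (rank_below W g + 2 = g)%N by have := WE g; rewrite !ltn_ord; lia.
have [->|ia] := eqVneq i a.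
  rewrite [W a]/W eqxx add0r; move: Da; congr congr_mod; congr (_%:~R * _).
  by have := WE a.+1; rewrite ltnSn ltnS (leqNgt b) ab /=; lia.
have [->|ib] := eqVneq i b.
  rewrite [W b]/W eqxx andbF add0r; move: Db; congr congr_mod; congr (_%:~R * _).
  by have := WE b.+1; rewrite ltnSn ltnS ltnW //=; lia.
rewrite [W i]/W ia ib /=; have [_ hi] := hth i.
apply: congr_mod_sym; have := congr_modD hi (congr_mod_refl (len i) (m i)).
by rewrite subrK.
Qed.

(** Let q be [rank_below Q i]. In [steps_forced] with h = 2, particle q takes its first step on
    cycle i at position i + q, and particle q - 1 its second one at i + q - 2. These are the two
    congruences, each stated when the particle is one of 0, ..., r. *)
Definition on_tableau (Q : pred nat) (r : nat) D : Prop := forall i, Q i ->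
  ((rank_below Q i <= r)%N -> congr_mod (len i) (AJ i D)
     ((deg D - i%:Z - (rank_below Q i)%:Z)%:~R * arc i)) /\
  ((0 < rank_below Q i)%N -> congr_mod (len i) (AJ i D)
     ((deg D - i%:Z - (rank_below Q i)%:Z + 2)%:~R * arc i)).

Lemma on_tableau_rank_ge Q r D : rank_below Q g = (r + 2)%N ->
  deg D = g%:Z - 2 + r%:Z -> on_tableau Q r D -> rank_ge r D.
Proof.
move=> Qg dD QD E /effectiveP[s [-> _]]; rewrite deg_seq => -[sr].
(* Against r chips, Q keeps two cycles without chips: the chips left of a are as many as the members
   of Q there, those left of b one fewer. The first congruence at a and the second at b then become
   the hypotheses of [equiv_chips]. *)
have [|||||a [b [/andP[ab bg] [ua ua1 qa] [ub ub1 qb]]]] :=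
    @descents (chips_below s) (rank_below Q) g.
- exact: chips_below0.
- by [].
- by move=> j; rewrite chips_belowS leq_addr.
- by move=> j; rewrite rank_belowS; case: (Q j); lia.
- by rewrite chips_below_all sr Qg.
have ag := ltn_trans ab bg; pose ia := Ordinal ag; pose ib := Ordinal bg.
have cE (i : 'I_g) : chips_below s i.+1 = chips_below s i ->
    AJ i (D - \sum_(p <- s) << p >>) =
    AJ i D - (r%:Z - (chips_below s i)%:Z)%:~R * arc i.
  rewrite chips_belowS => ci; rewrite raddfB /= abel_jacobi_empty_cycle ?sr //; lia.
have Qa : Q ia by move: qa; rewrite rank_belowS /=; case: (Q a); lia.
have Qb : Q ib by move: qb; rewrite rank_belowS /=; case: (Q b); lia.
have qag := rank_below_leq Q ab; have qbg := rank_below_leq Q bg.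
apply: (@equiv_chips _ ia ib) => //.
- by rewrite degB dD deg_seq sr addrK.
- have [H _] := QD ia Qa; have [|k kE] := H; first by rewrite /=; lia.
  by exists k; rewrite cE // kE dD /= -ua !(intrB, intrD); ring.
- have [_ H] := QD ib Qb; have [|k kE] := H; first by rewrite /= -ub.
  by exists k; rewrite cE // kE dD /= -ub intS !(intrB, intrD); ring.
Qed.

End Chips.

(** * Special cycles *)

Section MartensEquality.
Variables (R : realType) (g : nat) (C : chain_of_cycles R g).
Local Notation G := (chain_graph C).
Local Notation arc := (arc_len C).
Local Notation len := (cycle_len C).
Local Notation AJ := (abel_jacobi (C := C)).
Implicit Types (p q : point G) (D E X : divisor G) (t : R).
Implicit Types (s : seq (point G)) (b Z N Q : pred nat).

(** The positions to avoid are integer combinations of the arc and the length, hence countable,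
    while the circle has positive measure. *)
Lemma exists_generic_angle (i : 'I_g) : exists t, 0 <= t < len i /\
  forall c : int, ~ congr_mod (len i) t (c%:~R * arc i).
Proof.
apply: contrapT => none.
pose f (x : int * int) : R := x.1%:~R * arc i + x.2%:~R * len i.
have sub : `[0, len i[%classic `<=` range f.
  move=> t /=; rewrite in_itv /= => tl; apply: contrapT => nt; apply: none; exists t.
  by split=> // c [k kE]; apply: nt; exists (c, k).
have cnt : countable `[0, len i[%classic.
  apply: sub_countable (card_le_trans (subset_card_le sub) (card_image_le _ _)) _.
  exact: countableP.
have := countable_lebesgue_measure0 cnt.
rewrite lebesgue_measure_itv /= lte_fin len_gt0 oppr0 adde0 => -[l0].
by have := len_gt0 C i; rewrite l0 ltxx.
Qed.

Lemma exists_generic_angles : exists th : 'I_g -> R, forall i : 'I_g, 0 <= th i < len i /\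
  forall c : int, ~ congr_mod (len i) (th i) (c%:~R * arc i).
Proof. by have [th hth] := choice exists_generic_angle; exists th. Qed.

Lemma congr_mod_arc2 (i : 'I_g) (c : int) :
  congr_mod (len i) (c%:~R * arc i) ((c + 2)%:~R * arc i) -> 2 * arc i = len i.
Proof.
move=> [k]; rewrite intrD mulrDl => H.
have a0 := arc_len_gt0 C i; have al := arc_len_shortest C i.
have kE : 2 * arc i = (- k)%:~R * len i by rewrite intrN; lra.
have l0 := len_gt0 C i.
have k1 : (0 < - k)%R.
  have : 0 < (- k)%:~R * len i by rewrite -kE mulr_gt0.
  by rewrite pmulr_lgt0 // ltr0z.
have : (- k)%:~R * len i <= 1 * len i by rewrite -kE; lra.
rewrite ler_pM2r // -[1]/(1%:~R) ler_int => k2.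
by rewrite kE (_ : - k = 1) ?mul1r //; lia.
Qed.

Lemma torsion2P (i : 'I_g) : torsion C i = 2%N <-> 2 * arc i = len i.
Proof.
have a0 := arc_len_gt0 C i; have al := arc_len_shortest C i.
rewrite /torsion; case: asboolP => [irr|_].
  split=> // e; case: irr; apply/rationalP; exists 2, 1%N; rewrite -e.
  by rewrite mulfK ?gt_eqF // divr1.
split=> [|e].
  case: xgetP => // m _ [[m0 [k kE]] _] m2; rewrite m2 in kE.
  apply: (@congr_mod_arc2 _ (-2)); exists (- k).
  by rewrite addNr mul0r add0r !intrN mulNr mulNr -kE.
have not1 : ~ exists k : int, 1%:R * arc i = k%:~R * len i.
  move=> [k kE]; rewrite mul1r -e in kE.
  have : arc i * 1 = arc i * (k *+ 2)%:~R.
    by rewrite mulr1 -mulr_natr intrM [LHS]kE; ring.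
  move/(mulfI (lt0r_neq0 a0))/eqP; rewrite -[1]/(1%:~R) eqr_int.
  by rewrite -mulr_natr; lia.
have is2 : (0 < 2)%N /\ exists k : int, 2%:R * arc i = k%:~R * len i.
  by split=> //; exists 1; rewrite mul1r.
apply: xget_unique; first by split=> // -[|[|m]] // [//] _ H; case: (not1 H).
move=> m [[m0 mk] mmin]; apply/eqP; rewrite eqn_leq mmin //.
by case: m m0 mk {mmin} => [|[|m]] // _ H; case: (not1 H).
Qed.

(* The end cycles count as special, whatever their torsion. *)
Definition special (x : nat) : bool := [|| x == 0%N, x == g.-1 |
  if insub x is Some i then torsion C i != 2%N else false].

Lemma special_ord (i : 'I_g) : ~~ special i -> 2 * arc i = len i.
Proof.
by rewrite /special valK !negb_or negbK => /and3P[_ _ /eqP/torsion2P].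
Qed.

Definition special_gap (r : nat) : Prop := forall x y, (x < y < g)%N ->
  special x -> special y -> (x + r < y)%N.

Lemma rank_below_gap Q m n : (m <= n)%N -> (forall i, Q i -> ~~ (m <= i < n)%N) ->
  rank_below Q n = rank_below Q m.
Proof.
move=> mn none; rewrite -(subnKC mn) /rank_below iotaD count_cat add0n.
rewrite [X in (_ + X)%N](_ : _ = 0%N) ?addn0 //; apply/eqP; rewrite -leqn0 leqNgt -has_count.
apply/hasPn => i; rewrite mem_iota subnKC // => ii; apply/negP => Qi.
by have := none i Qi; rewrite ii.
Qed.

Lemma rank_below_leq_size Q (l : seq nat) n : (forall i, (i < n)%N -> Q i -> i \in l) ->
  (rank_below Q n <= size l)%N.
Proof.
move=> Ql; rewrite /rank_below -size_filter; apply: uniq_leq_size.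
  by rewrite filter_uniq ?iota_uniq.
by move=> i; rewrite mem_filter mem_iota => /andP[Qi /andP[_ ii]]; exact: Ql.
Qed.

Lemma size_leq_rank_below Q (l : seq nat) n : uniq l ->
  (forall i, i \in l -> Q i && (i < n)%N) -> (size l <= rank_below Q n)%N.
Proof.
move=> ul Ql; rewrite /rank_below -size_filter; apply: uniq_leq_size => // i /Ql.
by rewrite mem_filter mem_iota.
Qed.

Lemma exists_tableau r a c : special_gap r -> (a < c < g)%N ->
  exists Q, [/\ Q a, Q c, rank_below Q g = (r + 2)%N &
    forall i, Q i -> (0 < rank_below Q i <= r)%N -> ~~ special i].
Proof.
move=> gap acg.
(* A special a has to be the first member of Q and a special c the last; otherwise the ends of the
   chain serve as limits. *)
pose lo := if special a then a else 0%N; pose hi := if special c then c else g.-1.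
have slo : special lo by rewrite /lo; case: ifP.
have shi : special hi by rewrite /hi; case: ifP => // _; rewrite /special eqxx orbT.
have loa : (lo <= a)%N by rewrite /lo; case: ifP.
have chi : (c <= hi)%N by rewrite /hi; case: ifP => // _; lia.
have hig : (hi < g)%N by rewrite /hi; case: ifP => // _; lia.
have lohi : (lo + r < hi)%N by apply: gap => //; lia.
pose W i := (lo <= i <= hi)%N && [|| i == lo, i == hi | ~~ special i].
have Wa : W a.
  rewrite /W loa /= (_ : (a <= hi)%N); last by lia.
  by rewrite /lo; case: (boolP (special a)); rewrite ?eqxx ?orbT.
have Wc : W c.
  rewrite /W chi /= (_ : (lo <= c)%N); last by lia.
  by rewrite /hi; case: (boolP (special c)); rewrite ?eqxx ?orbT.
clearbody lo hi.
(* By the gap condition, the r cycles after [lo] are not special and precede [hi]; with both limits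
   this makes r + 2. *)
have Wr : (r + 2 <= rank_below W g)%N.
  have -> : (r + 2)%N = size (hi :: iota lo r.+1) by rewrite /= size_iota addn2.
  apply: size_leq_rank_below => [|i].
    by rewrite cons_uniq iota_uniq mem_iota; lia.
  rewrite inE mem_iota => /orP[/eqP ->|/andP[loi ir]].
    by rewrite /W leqnn eqxx orbT !andbT hig; lia.
  have ihi : (i <= hi)%N by lia.
  have ig : (i < g)%N by lia.
  rewrite /W loi ihi ig andbT /=.
  have [//|il /=] := eqVneq i lo; apply/orP; right; apply/negP => si.
  by have := gap lo i; rewrite slo si; lia.
have [|Q [QW Qa Qc Qr]] := exists_subset_of_size acg Wa Wc (m := (r + 2)%N).
  by rewrite Wr addn2.
(* Equal to [lo], a member would have rank 0; equal to [hi], rank r + 1. *)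
exists Q; split=> // i Qi /andP[q0 qr]; have /andP[_] := QW i Qi.
case/or3P => [/eqP iE|/eqP iE|//]; exfalso.
  have : rank_below Q i = 0%N; last by lia.
  rewrite (@rank_below_gap Q 0 i) // => j /QW /andP[/andP[loj _] _].
  by rewrite iE /= -leqNgt.
have : rank_below Q g = rank_below Q i.+1.
  apply: rank_below_gap; first by rewrite iE.
  by move=> j /QW /andP[/andP[_ jhi] _]; rewrite iE; lia.
by rewrite rank_belowS Qi Qr; lia.
Qed.

Lemma special_gap_covers r : (1 <= r <= g - 2)%N -> special_gap r ->
  covers C r (g%:Z - 2 + r%:Z) (g - 2 - r).
Proof.
move=> rg gap E E0 Er; have /effectiveP[s [Es _]] := E0.
have sz : size s = (g - 2)%N.
  by have := Er; rewrite Es deg_seq => -[->]; lia.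
(* E has two chips fewer than there are cycles: this yields chip-free cycles a and c with exactly a,
   respectively c - 1, chips on their left. *)
have [|||||a [c [acg [ua ua1 _] [uc uc1 _]]]] :=
    @descents (chips_below s) id g => //.
- exact: chips_below0.
- by move=> j; rewrite chips_belowS leq_addr.
- by rewrite chips_below_all sz; lia.
have [Q [Qa Qc Qr Qin]] := exists_tableau gap acg.
have /andP[ac cg] := acg; have ag := ltn_trans ac cg.
pose b i := [&& Q i, i != a & i != c].
have bE n : (rank_below b n + (a < n) + (c < n) = rank_below Q n)%N.
  elim: n => // n IH; rewrite !rank_belowS [b n]/b !ltnS.
  have [Qn|nQ] := boolP (Q n).
    by move: IH; case: (ltngtP n a) => na; case: (ltngtP n c) => nc /=; lia.
  have na : n != a by apply: contraNneq nQ => ->.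
  have nc : n != c by apply: contraNneq nQ => ->.
  by move: IH na nc; case: (ltngtP n a) => // na; case: (ltngtP n c) => // nc /=; lia.
have bg : rank_below b g = r by have := bE g; rewrite ag cg Qr; lia.
pose m (i : 'I_g) : R := ((rank_below b g)%:Z - (rank_below b i.+1)%:Z)%:~R * arc i.
pose d : int := g%:Z - 2 + r%:Z.
(* The first congruence of the tableau is prescribed, except on the last member of Q, which has only
   the second. On the others of positive rank, torsion 2 gives the second from the first. *)
pose u (i : 'I_g) : int :=
  d - i%:Z - (rank_below Q i)%:Z + (if (rank_below Q i <= r)%N then 0 else 2).
have [th hth] := exists_angles C (fun i => (u i)%:~R * arc i - AJ i E - m i).
have dEF : deg (E + chips C b th) = d by rewrite degD deg_chips bg Er /d; lia.
have EF (i : 'I_g) : Q i -> congr_mod (len i) (AJ i (E + chips C b th)) ((u i)%:~R * arc i).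
  move=> Qi; rewrite raddfD /= abel_jacobi_chips => [|j]; last by case: (hth j).
  rewrite -/(m i).
  (* No chip is added on a and c: the chip counts alone give the first congruence at a and the
     second at c. The other members of Q are adjusted by the angle of their new chip. *)
  have [ia|ia] := eqVneq (i : nat) a; last have [ic|ic] := eqVneq (i : nat) c.
  - rewrite /b ia eqxx andbF add0r {1}Es abel_jacobi_empty_cycle; last first.
      by have := chips_belowS s i; rewrite ia ua1; lia.
    rewrite sz /m bg /u ia ua (_ : (rank_below Q a <= r)%N); last first.
      by have := rank_below_leq Q ac; have := rank_below_leq Q cg; rewrite !rank_belowS Qa Qc; lia.
    have := bE a.+1; rewrite (rank_belowS Q) Qa ltnSn ltnS (leqNgt c) ac /= => ba.
    rewrite -mulrDl -intrD; exists 0; rewrite mul0r addr0; congr (_%:~R * _).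
    by rewrite /d; lia.
  - rewrite /b ic eqxx !andbF add0r {1}Es abel_jacobi_empty_cycle; last first.
      by have := chips_belowS s i; rewrite ic uc1; lia.
    have qc : (0 < rank_below Q c)%N.
      by have := rank_below_leq Q ac; rewrite rank_belowS Qa; lia.
    have := bE c.+1; rewrite (rank_belowS Q) Qc ltnSn ltnS (ltnW ac) /= => bc.
    have H : congr_mod (len i) (((size s)%:Z - (chips_below s i)%:Z)%:~R * arc i + m i)
        ((d - i%:Z - (rank_below Q i)%:Z + 2)%:~R * arc i).
      rewrite /m bg -mulrDl -intrD; exists 0; rewrite mul0r addr0; congr (_%:~R * _).
      rewrite sz /d ic; lia.
    apply: congr_mod_trans H _; rewrite /u; case: leqP => [qr|_]; last exact: congr_mod_refl.
    rewrite addr0; apply: congr_mod_sym; exists (-1).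
    rewrite intrN !(intrD, intrB) -(special_ord (Qin i Qi _)); first by ring.
    by rewrite ic qc -ic qr.
  - rewrite /b Qi ia ic /=; have [_ H] := hth i.
    have := congr_modD (congr_mod_refl _ (AJ i E)) (congr_modD H (congr_mod_refl _ (m i))).
    by rewrite /= subrK [AJ i E + (_ - _)]addrC subrK.
have tab : on_tableau Q r (E + chips C b th).
  move=> i Qi; rewrite dEF; have := EF i Qi; rewrite /u.
  case: (leqP (rank_below Q i) r) => qr /=; last by move=> H; split.
  rewrite addr0 => H; split=> // q0.
  have qi : (0 < rank_below Q i <= r)%N by rewrite q0.
  apply: congr_mod_trans H _; exists (-1).
  by rewrite intrN !(intrD, intrB) -(special_ord (Qin i Qi qi)); ring.
exists (E + chips C b th); split.
- exact: effectiveD (chips_effective _ _ _).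
- exact: dEF.
- by apply/rankP; apply: on_tableau_rank_ge tab.
- by rewrite addrAC subrr add0r; exact: chips_effective.
Qed.

(* A generic chip is trivial at no position, so particles can step only on the
   cycles of Z and on those carrying chips of F. *)
Lemma generic_steps Z (th : 'I_g -> R) s r D : (forall i : 'I_g, 0 <= th i < len i /\
    forall c : int, ~ congr_mod (len i) (th i) (c%:~R * arc i)) ->
  D = chips C (predC Z) th + \sum_(p <- s) << p >> ->
  deg D = g%:Z - 2 + r%:Z -> rank_ge r D ->
  let Q := fun j => (j < g)%N && (Z j || (j \in [seq val (locate p).1 | p <- s])) in
  (r + 2 <= rank_below Q g)%N /\
  (rank_below Q g = (r + 2)%N -> forall i : 'I_g, Q i -> (0 < rank_below Q i <= r)%N ->
     2 * arc i = len i).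
Proof.
move=> gen De dD rD Q.
pose T := trivial_at D (deg D).
have TQ j z : T j z -> Q j.
  rewrite /T /trivial_at; case: insubP => // i _ <- /asboolP tz.
  rewrite /Q ltn_ord /=; apply/negPn; rewrite negb_or; apply/negP => /andP[nZ ns].
  move: tz; rewrite [in X in congr_mod _ X _]De raddfD /= abel_jacobi_chips; last first.
    by move=> i'; case: (gen i').
  rewrite abel_jacobi_empty_cycle; last first.
    apply/eqP; rewrite -leqn0 leqNgt -has_count; apply: contra ns => /hasP[p ps /eqP pi].
    by apply/mapP; exists p.
  rewrite /= nZ; set x := _ - _; set y := _ - _; set w := _ - _ => tz.
  have [_ /(_ (w - x - y))] := gen i; apply.
  have := congr_modD tz (congr_mod_refl _ (- (x%:~R * arc i) - y%:~R * arc i)).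
  by congr congr_mod; rewrite ?intrB; ring.
have st : (2 <= steps T g r)%N.
  have := particle_bound rD; rewrite -/T dD /steps.
  have := particle_ge T g r; have := genus_gt0 C; lia.
split=> [|Qr i Qi /andP[q0 qr]].
  by have := @steps_count T Q TQ g r; lia.
(* With q the rank of i in Q, particles q and q - 1 both step here, two positions apart. *)
have [|T1 p1] := steps_forced TQ Qr st (ltn_ord i) Qi qr; first by lia.
have [||T2 p2] := steps_forced TQ Qr st (ltn_ord i) Qi (k := (rank_below Q i).-1); [lia|lia|].
have pE : (particle T i (rank_below Q i).-1 + 2 = particle T i (rank_below Q i))%N by lia.
apply: (@congr_mod_arc2 i (deg D - (particle T i (rank_below Q i))%:Z)).
have := congr_mod_trans (congr_mod_sym (trivial_atE T1)) (trivial_atE T2).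
by congr congr_mod; congr (_%:~R * _); lia.
Qed.

Lemma covers_special_gap r : (1 <= r <= g - 2)%N ->
  covers C r (g%:Z - 2 + r%:Z) (g - 2 - r) -> special_gap r.
Proof.
move=> rg cov x y /andP[xy yg] sx sy; rewrite ltnNge; apply/negP => yxr.
have [th gen] := exists_generic_angles.
pose Z := pred2 x y.
have ZE n : (rank_below (predC Z) n + (x < n) + (y < n) = n)%N.
  elim: n => // n IH; rewrite rank_belowS /= !ltnS.
  by move: IH; case: (ltngtP n x) => ?; case: (ltngtP n y) => ? /=; lia.
have Zg : (rank_below (predC Z) g + 2 = g)%N by have := ZE g; lia.
have [||D [D0 dD rD DE]] := cov (chips C (predC Z) th).
- exact: chips_effective.
- by rewrite deg_chips; congr Posz; lia.
have /effectiveP[s [Fs dF]] := DE.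
have De : D = chips C (predC Z) th + \sum_(p <- s) << p >> by rewrite -Fs addrC subrK.
have sr : size s = r by move: dF; rewrite degB dD deg_chips; lia.
move/rankP: rD => rD.
have [] := generic_steps gen De dD rD; set Q := (fun j : nat => _) => Q1 Q2.
(* D - E has only r chips, so together with x and y the required number of cycles is just
   reached. *)
have {}Q1 : rank_below Q g = (r + 2)%N.
  apply/eqP; rewrite eqn_leq Q1 andbT.
  have := @rank_below_leq_size Q (x :: y :: [seq val (locate p).1 | p <- s]) g.
  rewrite /= size_map sr addn2; apply=> i ig /andP[_].
  by rewrite /= !inE orbA.
have {}Q2 z : (z < g)%N -> Q z -> special z -> z != 0%N -> z != g.-1 ->
    ~~ (0 < rank_below Q z <= r)%N.
  move=> zg Qz sz z0 zl; apply/negP => qz.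
  have := Q2 Q1 (Ordinal zg) Qz qz => /torsion2P t2.
  by move: sz; rewrite /special (negbTE z0) (negbTE zl) (insubT (fun m => m < g)%N zg) t2.
have xg := ltn_trans xy yg.
have Qx : Q x by rewrite /Q xg /= eqxx.
have Qy : Q y by rewrite /Q yg /= eqxx orbT.
have qxy := rank_below_leq Q xy; have qyg := rank_below_leq Q yg.
rewrite !rank_belowS Qx Qy Q1 in qxy qyg.
have y0 : y != 0%N by lia.
have xl : x != g.-1 by lia.
(* A special cycle can only be the first or the last member of Q; since y comes later, x is the
   first, and likewise y is the last. *)
have qx : rank_below Q x = 0%N.
  have [->//|x0] := eqVneq x 0%N.
  by have := Q2 x xg Qx sx x0 xl; clear -qxy qyg; lia.
have qy : rank_below Q y = r.+1.
  have [yl|yl] := eqVneq y g.-1.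
    have : rank_below Q y.+1 = (r + 2)%N by rewrite yl (prednK (genus_gt0 C)).
    by rewrite rank_belowS Qy; clear; lia.
  by have := Q2 y yg Qy sy y0 yl; clear -qxy qyg; lia.
(* From x up to y, with y excluded, there are r + 1 members of Q, hence at least r + 1 cycles. *)
have := rank_below_leqD Q x (y - x); rewrite (subnKC (ltnW xy)) qx qy.
by clear -yxr; lia.
Qed.

Lemma covers_bound r m : (1 <= r <= g - 2)%N ->
  covers C r (g%:Z - 2 + r%:Z) m -> (m <= g - 2 - r)%N.
Proof.
move=> rg cov; rewrite leqNgt; apply/negP => mlt.
have [th gen] := exists_generic_angles.
(* With g - 1 generic chips in E, only r - 1 other chips of D remain, and at most r cycles allow a
   step. The surplus N of E is counted among those r - 1 chips. *)
pose Z := pred1 g.-1.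
have ZE n : (n < g)%N -> rank_below (predC Z) n = n.
  elim: n => // n IH ng; rewrite rank_belowS IH ?(ltnW ng) //= (_ : n != g.-1); lia.
have Zg : rank_below (predC Z) g = g.-1.
  have : rank_below (predC Z) g.-1.+1 = g.-1.
    by rewrite rank_belowS ZE /= ?eqxx ?addn0 // (prednK (genus_gt0 C)).
  by rewrite (prednK (genus_gt0 C)).
pose v0 := cycle_point C (Ordinal (genus_gt0 C)) 0.
pose N : divisor G := \sum_(p <- nseq (m + r - g.-1) v0) << p >>.
have [||D [D0 dD rD DE]] := cov (chips C (predC Z) th + N).
- exact: effectiveD (chips_effective _ _ _) (effective_seq _).
- by rewrite degD deg_chips deg_seq size_nseq -PoszD; congr Posz; lia.
have DE' : effective (D - chips C (predC Z) th).
  have := effectiveD DE (effective_seq (nseq (m + r - g.-1) v0)); congr effective.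
  rewrite -/N; divisor_ring.
have /effectiveP[s [Fs dF]] := DE'.
have De : D = chips C (predC Z) th + \sum_(p <- s) << p >> by rewrite -Fs addrC subrK.
have sr : (size s).+1 = r.
  by move: dF; rewrite degB dD deg_chips Zg; have := genus_gt0 C; lia.
move/rankP: rD => rD.
have [+ _] := generic_steps gen De dD rD; set Q := (fun j : nat => _) => Q1.
have := @rank_below_leq_size Q (g.-1 :: [seq val (locate p).1 | p <- s]) g.
rewrite /= size_map sr => H; suff : (rank_below Q g <= r)%N by lia.
by apply: H => i ig /andP[_]; rewrite /= !inE.
Qed.

Lemma hyperelliptic_special : (3 <= g)%N -> hyperelliptic G ->
  forall i : 'I_g, special i -> i = 0%N :> nat \/ i = g.-1 :> nat.
Proof.
move=> g3 [D [dD rD]] i si.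
have {rD} /rankP rD : (1%:Z <= rank D)%R by rewrite rD.
have [->|i0] := eqVneq (i : nat) 0%N; first by left.
have [->|il] := eqVneq (i : nat) g.-1; first by right.
exfalso; pose T := trivial_at D (deg D); pose Q j := (j < g)%N.
have TQ j z : T j z -> Q j.
  by rewrite /T /trivial_at; case: insubP => // i' _ <- _; exact: ltn_ord.
have QE n : (n <= g)%N -> rank_below Q n = n.
  by elim: n => // n IH ng; rewrite rank_belowS (IH (ltnW ng)) /Q ng addn1.
(* Degree 2 lets particle 1 advance at most once. Forcing with all cycles and h = g - 1 makes both
   particles step on every inner cycle, at positions 0 and 2. *)
have st : (g.-1 <= steps T g 1)%N.
  by have := particle_bound rD; rewrite -/T dD /steps; lia.
have Qg : rank_below Q g = (1 + g.-1)%N by rewrite QE // add1n (prednK (genus_gt0 C)).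
have qi : rank_below Q i = i by rewrite (QE _ (ltnW (ltn_ord i))).
have ig := ltn_ord i.
have [//||T1 p1] := steps_forced TQ Qg st (ltn_ord i) (ltn_ord i) (k := 1%N).
  by rewrite qi; lia.
have [//||T0 p0] := steps_forced TQ Qg st (ltn_ord i) (ltn_ord i) (k := 0%N).
  by rewrite qi; lia.
suff : 2 * arc i = len i.
  move=> /torsion2P t2; move: si.
  by rewrite /special (negbTE i0) (negbTE il) valK t2.
apply: (@congr_mod_arc2 i (deg D - (particle T i 1)%:Z)).
have := congr_mod_trans (congr_mod_sym (trivial_atE T1)) (trivial_atE T0).
by congr congr_mod; congr (_%:~R * _); lia.
Qed.

Lemma special_hyperelliptic :
  (forall i : 'I_g, special i -> i = 0%N :> nat \/ i = g.-1 :> nat) ->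
  hyperelliptic G.
Proof.
move=> sp; pose i0 := Ordinal (genus_gt0 C).
pose w : point G := inl (i0, true); pose D : divisor G := << w >> *+ 2.
have dD : deg D = 2 by rewrite raddfMn /= degU.
have AD j : AJ j D = (if j == i0 then arc j else 0) *+ 2.
  have jw : (j < (locate w).1)%N = false by [].
  rewrite raddfMn /= abel_jacobiU /retract jw /=; congr (_ *+ 2).
  by have [->|/negbTE ji] := eqVneq j i0; rewrite ?eqxx ?ji.
exists D; split=> //; apply/eqP; rewrite eq_le; apply/andP; split; last first.
  apply/rankP => E E0 /(deg1pos E0)[p ->].
  (* The partner of p lies on the same cycle. On earlier cycles other than the first, the
     coordinates are off by twice the arc, which is the length there. *)
  have [t ht tE] := congr_mod_range (AJ (locate p).1 D - (locate p).2) (len_gt0 C (locate p).1).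
  exists << cycle_point C (locate p).1 t >>.
    by apply/fgposP => q; rewrite coeffU mul1r; case: eqP.
  apply: abel_jacobi_equiv => [|j]; first by rewrite degB dD !degU.
  rewrite raddfB /= !abel_jacobiU retract_cycle_point // /retract.
  case: ltngtP => [jp|pj|jp]; last first.
  - have -> : j = (locate p).1 by exact: val_inj.
    by rewrite eqxx.
  - rewrite [j == _]eq_sym lt_eqF // AD [j == i0](_ : _ = false); last first.
      by apply/eqP => ji; move: pj; rewrite ji.
    by rewrite mul0rn subr0; exact: congr_mod_refl.
  rewrite AD; case: eqP => [_|ji].
    by exists 0; rewrite mul0r addr0 mulr2n addrK.
  rewrite mul0rn sub0r; exists (-1).
  rewrite -(special_ord (i := j)); first by rewrite intrN; ring.
  apply/negP => /sp[j0|jl].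
    by apply: ji; exact: val_inj.
  by have := ltn_ord (locate p).1; lia.
(* With rank 2, particle 2 would step on all g cycles, whereas exclusion costs it two of them. *)
rewrite leNgt; apply/negP => r2.
have {r2} /rankP rD : (2%:Z <= rank D)%R by lia.
pose T := trivial_at D (deg D); pose Q j := (j < g)%N.
have TQ j z : T j z -> Q j.
  by rewrite /T /trivial_at; case: insubP => // i' _ <- _; exact: ltn_ord.
have QE n : (n <= g)%N -> rank_below Q n = n.
  by elim: n => // n IH ng; rewrite rank_belowS (IH (ltnW ng)) /Q ng addn1.
have st : (g <= steps T g 2)%N.
  by have := particle_bound rD; rewrite -/T dD /steps; lia.
have := @steps_count T Q TQ g 2; rewrite QE //; have := genus_gt0 C; lia.
Qed.

End MartensEquality.

(** * The gap condition and Martens-special chains *)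

Section MartensSpecial.
Variables (R : realType) (g : nat) (C : chain_of_cycles R g).

Lemma martens_special_gap r : (1 <= r <= g - 2)%N -> martens_special C r ->
  special_gap C r.
Proof.
move=> rg [_ [j [_ /allP jb js _ jt]]] x y /andP[xy yg].
have specialE z : (z < g)%N -> special C z -> [\/ z = 0%N, z = g.-1 | z.+1 \in j].
  move=> zg; rewrite /special (insubT (fun m => m < g)%N zg).
  have [z0 _|z0] := eqVneq z 0%N; first by constructor 1.
  have [zl _|zl] := eqVneq z g.-1; first by constructor 2.
  move=> /= /eqP tz; constructor 3; apply/negPn/negP => zj; apply: tz.
  by apply: (jt (Ordinal zg)) => //=; lia.
have gapj u v : u \in j -> v \in j -> (u < v)%N -> (u + (r + 1) <= v)%N.
  move=> uj vj uv; have [a aj ua] := nthP 0%N uj; have [b bj vb] := nthP 0%N vj.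
  have tr : transitive (fun x y => (x + (r + 1) <= y)%N) by move=> ? ? ? /=; lia.
  have H := sorted_ltn_nth tr 0%N js.
  have [ab|ba|ab] := ltngtP a b.
  - by have := H a b aj bj ab; rewrite ua vb.
  - by have := H b a bj aj ba; rewrite ua vb; lia.
  - by move: uv; rewrite -ua -vb ab ltnn.
move=> /(specialE x (ltn_trans xy yg)) sx /(specialE y yg) sy.
(* Numbers in j exceed indices by one, so [r + 1 < x < g - r] means distance at least r + 1 from
   both ends. *)
case: sx => [x0|xl|xj]; case: sy => [y0|yl|yj].
all: try by lia.
- by have := jb _ yj; lia.
- by have := jb _ xj; lia.
- by have := gapj _ _ xj yj; lia.
Qed.

Lemma special_gap_martens r : special_gap C r ->
  ~ (forall i : 'I_g, special C i -> i = 0%N :> nat \/ i = g.-1 :> nat) ->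
  martens_special C r.
Proof.
move=> gap inner.
have s0 : special C 0 by rewrite /special eqxx.
have sl : special C g.-1 by rewrite /special eqxx orbT.
pose P i := [&& (0 < i)%N, (i < g.-1)%N & special C i].
pose j := [seq i.+1 | i <- iota 0 g & P i].
have jP i : (i.+1 \in j) = P i.
  rewrite mem_map ?mem_filter ?mem_iota; last exact: succn_inj.
  by rewrite /= add0n andb_idr // => /and3P[_ + _]; lia.
have Pb i : P i -> (r < i)%N /\ (i + r < g.-1)%N.
  move=> /and3P[i0 il si]; split.
    by have := gap 0%N i; rewrite s0 si; lia.
  by have := gap i g.-1; rewrite sl si; lia.
have [i Pi] : exists i, P i.
  apply: contrapT => none; apply: inner => i si.
  have [->|i0] := eqVneq (i : nat) 0%N; first by left.
  have [->|il] := eqVneq (i : nat) g.-1; first by right.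
  by exfalso; apply: none; exists i; rewrite /P si; have := ltn_ord i; lia.
(* An inner special cycle is at distance at least r + 1 from both ends, which gives the bound on the
   genus. *)
split; first by have := Pb i Pi; lia.
exists j; split.
- by have := jP i; rewrite Pi; case: (j).
- by apply/allP => -[|k]; [move=> /mapP[]|rewrite jP => /Pb; lia].
- rewrite sorted_map; apply: pairwise_sorted.
  have : pairwise ltn [seq i <- iota 0 g | P i].
    by apply: pairwise_filter; rewrite -sorted_pairwise ?iota_ltn_sorted //; exact: ltn_trans.
  have aP := filter_all P (iota 0 g).
  apply: sub_in_pairwise aP => a b Pa Pb' /= ab.
  have /and3P[_ al sa] : P a by exact: Pa.
  have /and3P[_ bl sb] : P b by exact: Pb'.
  by have := gap a b; rewrite sa sb; lia.
- move=> k; rewrite jP => /and3P[k0 kl]; rewrite /special valK.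
  by rewrite (gtn_eqF k0) (ltn_eqF kl) => /eqP.
- move=> k kb; rewrite jP => nP; apply/eqP; apply: contraR nP => tk.
  by rewrite /P /special valK tk !orbT; lia.
Qed.

Lemma special_gapP r : (1 <= r <= g - 2)%N ->
  special_gap C r <-> hyperelliptic (chain_graph C) \/ martens_special C r.
Proof.
move=> rg; split=> [gap|[hyp|]]; last exact: martens_special_gap.
  have [all_end|] := pselect (forall i : 'I_g, special C i -> i = 0%N :> nat \/ i = g.-1 :> nat).
    by left; exact: special_hyperelliptic.
  by right; exact: special_gap_martens.
move=> x y /andP[xy yg] sx sy; have g3 : (3 <= g)%N by lia.
have := hyperelliptic_special g3 hyp (i := Ordinal (ltn_trans xy yg)) sx.
have := hyperelliptic_special g3 hyp (i := Ordinal yg) sy.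
by move=> /= [] ? [] ?; lia.
Qed.

End MartensSpecial.

Theorem theoremB (R : realType) (g : nat) (C : chain_of_cycles R g) (r : nat)
    (hr : (1 <= r <= g - 2)%N) :
  brill_noether_rank (chain_graph C) r (Posz g - 2 + Posz r) =
    Posz g - 2 - Posz r
  <-> hyperelliptic (chain_graph C) \/ martens_special C r.
Proof.
have -> : Posz g - 2 - Posz r = (g - 2 - r)%N by lia.
apply: iff_trans (special_gapP C hr).
apply: iff_trans (brill_noether_rankP _) _ => [m|]; first exact: covers_bound.
by split; [exact: covers_special_gap|exact: special_gap_covers].
Qed.
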